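(* Fix real $x$, and for positive $a\to\infty$ let $n:=\lceil a-x\sqrt{2a}\rceil$. (i) Let $(a_j)$ be a sequence of positive reals with $a_j\to\infty$ and let $n_j:=\lceil a_j-x\sqrt{2a_j}\rceil$. If $(\nu_{n_j})$ is a convergent sequence of zeros of the Charlier polynomials, $c^{a_j}_{n_j}(\nu_{n_j})=0$, with $\nu_{n_j}\to\nu$, then the limit $\nu$ is a zero of the Hermite function, $H_\nu(x)=0$, and $\nu=\nu_{n_j}+O(1/\sqrt{a_j})$ as $j\to\infty$. (ii) Conversely, if $\nu$ is a positive real number with $H_\nu(x)=0$, then for every sequence of positive reals $a_j\to\infty$, with $n_j:=\lceil a_j-x\sqrt{2a_j}\rceil$, there is a sequence $\nu_{n_j}\to\nu$ with $c^{a_j}_{n_j}(\nu_{n_j})=0$ (for all sufficiently large $j$) satisfying $\nu=\nu_{n_j}+O(1/\sqrt{a_j})$ as $j\to\infty$.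
   Context: For $a>0$ and integer $n\ge 0$, the Charlier polynomial is $c_n^a(z):=\sum_{k=0}^{n}\binom{n}{k}\binom{z}{k}k!\,(-a)^{-k}$, where $\binom{z}{k}:=z(z-1)\cdots(z-k+1)/k!$ for $k\ge1$ and $\binom{z}{0}:=1$. $\lceil x\rceil$ is the smallest integer not smaller than $x$; only $a$ large enough that $\lceil a-x\sqrt{2a}\rceil\ge 0$ are considered. For real $\nu,x$ the Hermite function is $$H_\nu(x):=2^\nu\sqrt\pi\left[\frac{1}{\Gamma\left(\frac{1-\nu}{2}\right)}M\left(-\frac{\nu}{2};\frac12;x^2\right)-\frac{2x}{\Gamma\left(-\frac{\nu}{2}\right)}M\left(\frac{1-\nu}{2};\frac32;x^2\right)\right],$$ where $M$ is the confluent hypergeometric function of the first kind and $1/\Gamma$ is interpreted as $0$ at non-positive integers. Zeros of the Hermite function are meant here as values of $\nu$ with $H_\nu(x)=0$ for the given $x$. *)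

(* Defs.v *)
From mathcomp Require Export all_boot all_order all_algebra.
From mathcomp Require Export all_classical all_reals all_analysis.
Export Order.TTheory GRing.Theory Num.Theory.
Export numFieldNormedType.Exports.

Set Implicit Arguments.
Unset Strict Implicit.
Unset Printing Implicit Defensive.

Local Open Scope classical_set_scope.
Local Open Scope ring_scope.

(** (z)_k = z (z + 1) ... (z + k - 1) *)
Definition rising_fact (R : realType) (z : R) (k : nat) : R :=
  \prod_(i < k) (z + i%:R).

Definition gen_binom (R : realType) (z : R) (k : nat) : R :=
  (\prod_(i < k) (z - i%:R)) / k`!%:R.

Definition charlier (R : realType) (a : R) (n : nat) (z : R) : R :=
  \sum_(k < n.+1) 'C(n, k)%:R * gen_binom z k * k`!%:R * (- a) ^- k.

(** Euler's integral; it is the Gamma function only for [0 < z]. *)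
Definition euler_gamma (R : realType) (z : R) : R :=
  \int[@lebesgue_measure R]_(t in `]0, +oo[) (t `^ (z - 1) * expR (- t)).

(** 1 / Gamma on the whole real line, from the functional equation
    Gamma(z + m) = z (z + 1) ... (z + m - 1) Gamma(z).  The chosen m satisfies
    1 <= z + m, so that Euler's integral converges at z + m, and it exceeds -z,
    so that the product vanishes when z is a non-positive integer. *)
Definition inv_gamma (R : realType) (z : R) : R :=
  let m := `|Num.floor z|%N.+1 in rising_fact z m / euler_gamma (z + m%:R).

(** The confluent hypergeometric function of the first kind, M(a; b; z), for
    b not a non-positive integer. *)
Definition kummerM (R : realType) (a b z : R) : R :=
  limn (pseries (fun k => rising_fact a k / (rising_fact b k * k`!%:R)) z).

Definition hermite (R : realType) (nu x : R) : R :=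
  2 `^ nu * Num.sqrt pi *
  (inv_gamma ((1 - nu) / 2) * kummerM (- nu / 2) (1 / 2) (x ^+ 2)
   - 2 * x * inv_gamma (- nu / 2) * kummerM ((1 - nu) / 2) (3 / 2) (x ^+ 2)).

(** ceil (a - x sqrt(2a)), a degree only when it is nonnegative. *)
Definition charlier_index (R : realType) (x a : R) : int :=
  Num.ceil (a - x * Num.sqrt (2 * a)).

(* Main.v *)
Require Import Defs.
From mathcomp Require Import measurable_realfun ring lra zify.

(** Put c = sqrt(2a), n = a - xi c and h_n(z) = c^z c_n^a(z).  For s > 0, expanding
    Gamma(s) c_n(-s) = \int_0^oo t^(s-1) e^(-t) (1 + t/a)^n dt and substituting
    t = c u gives Gamma(s) h_n(-s) = \int u^(s-1) e^(-u^2 - 2 xi u) du + O(1/c), and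
    the limit integral is a multiple of H_{-s}(xi), as its expansion in powers of xi
    shows.  In the variable z, c_n and H satisfy three-term recurrences whose
    coefficients agree up to O(1/c), so the estimate propagates from negative z to
    all z, uniformly for bounded xi and locally uniformly in z.

    For the rate, no derivative of H in nu is needed.  The ratio
    Q(z) = h_n(z) / (z h_{n-1}(z-1)) has by Christoffel--Darboux a derivative equal to
    minus a sum of squares.  Since h_k(z) - h_{k+1}(z) = (2z/c) h_k(z-1) and
    h_k(z-1) stays near H_{nu-1}(x) <> 0, about c terms of this sum are bounded
    below, so Q' <= -mu < 0 near nu uniformly in a.  As Q(nu) = O(1/c), zeros of c_n
    near nu lie within O(1/c) of it, and the intermediate value theorem provides
    one. *)

Set Implicit Arguments.
Unset Strict Implicit.
Unset Printing Implicit Defensive.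

Local Open Scope classical_set_scope.
Local Open Scope ring_scope.

(** * Integrals over the positive half-line *)

Section half_line.
Variable R : realType.
Local Notation mu := (@lebesgue_measure R).
Implicit Types (f g : R -> R) (t : R).

(** The estimate h_n(nu) = O(1/c) alone does not locate zeros: both the rate and the existence of
    nearby zeros need a crossing with slope bounded below, and the monotone ratio Q supplies it.
    Bounding that slope involves degrees n - m with m of order c, and lowering the degree by m moves
    xi by m/c, which does not tend to 0. Hence the asymptotics keeps xi as a variable of its own
    beside x, with an error linear in 1/c, |z - nu| and |xi - x|; the same variable absorbs the
    rounding by the ceiling.

    The integral serves only negative z = -s. Keeping s >= 2 leaves the integrands bounded at 0 even
    after comparing two powers of u has cost a factor 1/u. The factor Gamma(s) is carried along
    instead of being divided out: the recurrence in z is linear, so Gamma(s) multiplies every term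
    and survives to the end as a positive factor that affects neither zeros nor signs. *)

Definition Int f := \int[mu]_(t in `](0 : R), +oo[) f t.

(* Every integrand below is O(e^(-t/2)); this class, stable under linear
   combinations, replaces integrability. *)
Definition exp_bounded f K := forall t, 0 <= t -> `|f t| <= K * expR (- t / 2).

Definition exp_dominated f :=
  measurable_fun `](0 : R), +oo[ f /\ exists K, exp_bounded f K.

Lemma cvg_exphalf : expR (- t / 2 : R) @[t --> +oo] --> (0 : R).
Proof.
rewrite (_ : (fun t : R => expR (- t / 2)) =
  (fun z => expR (- z)) \o (fun z => 2^-1 * z)); last first.
  by apply: eq_fun => x; rewrite mulNr mulrC.
apply: (@cvg_comp _ _ _ _ _ _ (pinfty_nbhs R)); last exact: cvgr_expR.
exact: gt0_cvgMry.
Qed.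

Lemma continuous_exphalf : continuous (fun t : R => expR (- t / 2)).
Proof.
move=> t; apply: continuous_comp; last exact: continuous_expR.
by apply: cvgM; [exact: cvgN|exact: cvg_cst].
Qed.

Lemma is_derive_exphalf (k t : R) :
  is_derive t 1 (fun t : R => k * expR (- t / 2)) (- (k / 2 * expR (- t / 2))).
Proof.
apply: is_derive_eq.
by rewrite /GRing.scale/= !mulr0 add0r; ring.
Qed.

Lemma itv0y_cbnd f : measurable_fun `](0 : R), +oo[ f ->
  (\int[mu]_(t in `](0 : R)%R, +oo[) (f t)%:E = \int[mu]_(t in `[0%R, +oo[) (f t)%:E)%E.
Proof.
by move=> mf; rewrite integral_itv_obnd_cbnd//; exact/measurable_EFinP.
Qed.

Lemma continuous_exp_dom f K : {within `[0, +oo[, continuous f} ->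
  exp_bounded f K -> exp_dominated f.
Proof.
move=> cf fK; split; last by exists K.
apply: open_continuous_measurable_fun => //.
by move: cf => /continuous_within_itvcyP[/in_continuous_mksetP].
Qed.

Lemma exphalf_dom : exp_dominated (fun t => expR (- t / 2)).
Proof.
apply: (@continuous_exp_dom _ 1).
  exact/continuous_subspaceT/continuous_exphalf.
by move=> t _; rewrite ger0_norm ?expR_ge0// mul1r.
Qed.

Lemma integral_exphalf :
  (\int[mu]_(t in `](0 : R)%R, +oo[) (expR (- t / 2))%:E = 2%:E)%E.
Proof.
rewrite itv0y_cbnd; last by have [] := exphalf_dom.
rewrite (@ge0_continuous_FTC2y _ _ (fun t => - 2 * expR (- t / 2)) _ 0)//.
- by rewrite oppr0 mul0r expR0 mulr1 sub0e -EFinN opprK.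
- exact/continuous_subspaceT/continuous_exphalf.
- by rewrite -[X in _ --> X](mulr0 (- 2)); apply: cvgMr; exact: cvg_exphalf.
- by apply: cvg_at_right_filter; apply: cvgMr; exact: continuous_exphalf.
- move=> t _; rewrite derive1E; have [_ ->] := is_derive_exphalf (-2) t.
  by field.
Qed.

Lemma exp_dom_integrable f : exp_dominated f ->
  mu.-integrable `](0 : R), +oo[ (EFin \o f).
Proof.
move=> [mf [K fK]].
have mD : measurable (`](0 : R), +oo[%classic) by [].
pose g := fun t : R => K * expR (- t / 2).
have := @le_integrable _ _ R mu _ mD (EFin \o f) (EFin \o g); apply.
- exact/measurable_EFinP.
- move=> t /=; rewrite in_itv/= andbT => t0.
  by rewrite lee_fin (le_trans (fK _ (ltW t0)))// ler_norm.
- have := @integrableZl _ _ R mu _ mD K (EFin \o (fun t => expR (- t / 2))); apply.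
  apply/integrableP; split.
    by apply/measurable_EFinP; have [] := exphalf_dom.
  under eq_integral do rewrite /= ger0_norm ?expR_ge0//.
  by rewrite integral_exphalf ltry.
Qed.

Lemma exp_domD f g : exp_dominated f -> exp_dominated g ->
  exp_dominated (fun t => f t + g t).
Proof.
move=> [mf [K fK]] [mg [L gL]]; split; first exact: measurable_funD.
exists (K + L) => t t0; rewrite mulrDl (le_trans (ler_normD _ _))// lerD//.
  exact: fK.
exact: gL.
Qed.

Lemma exp_domZ f k : exp_dominated f -> exp_dominated (fun t => k * f t).
Proof.
move=> [mf [K fK]]; split; first exact: measurable_funM.
exists (`|k| * K) => t t0; rewrite normrM -mulrA ler_wpM2l//.
exact: fK.
Qed.

Lemma exp_domB f g : exp_dominated f -> exp_dominated g ->
  exp_dominated (fun t => f t - g t).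
Proof.
move=> df dg; have := exp_domD df (exp_domZ (-1) dg).
by under [X in exp_dominated X -> _]eq_fun do rewrite mulN1r.
Qed.

Lemma exp_dom_sum n (F : nat -> R -> R) : (forall k, exp_dominated (F k)) ->
  exp_dominated (fun t => \sum_(k < n) F k t).
Proof.
move=> dF; elim: n => [|n IH].
  under eq_fun do rewrite big_ord0.
  by split => //; exists 0 => t _; rewrite normr0 mul0r.
by under eq_fun do rewrite big_ord_recr/=; apply: exp_domD.
Qed.

Lemma IntD f g : exp_dominated f -> exp_dominated g ->
  Int (fun t => f t + g t) = Int f + Int g.
Proof. by move=> df dg; apply: RintegralD => //; exact: exp_dom_integrable. Qed.

Lemma IntB f g : exp_dominated f -> exp_dominated g ->
  Int (fun t => f t - g t) = Int f - Int g.
Proof. by move=> df dg; apply: RintegralB => //; exact: exp_dom_integrable. Qed.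

Lemma IntZ f k : exp_dominated f -> Int (fun t => k * f t) = k * Int f.
Proof. by move=> df; apply: RintegralZl => //; exact: exp_dom_integrable. Qed.

Lemma Int_sum n (F : nat -> R -> R) : (forall k, exp_dominated (F k)) ->
  Int (fun t => \sum_(k < n) F k t) = \sum_(k < n) Int (F k).
Proof.
move=> dF; elim: n => [|n IH].
  rewrite big_ord0 /Int; under eq_Rintegral do rewrite big_ord0.
  by rewrite Rintegral_cst// mul0r.
rewrite big_ord_recr/= -IH -IntD//; last exact: exp_dom_sum.
by apply: eq_Rintegral => t _; rewrite big_ord_recr.
Qed.

Lemma eq_Int f g : (forall t, 0 < t -> f t = g t) -> Int f = Int g.
Proof.
move=> fg; apply: eq_Rintegral => t; rewrite inE/= in_itv/= andbT.
exact: fg.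
Qed.

Lemma Int_exphalf : Int (fun t => expR (- t / 2)) = 2.
Proof. by rewrite /Int /Rintegral integral_exphalf. Qed.

Lemma Int_norm_le f K : exp_dominated f -> exp_bounded f K -> `|Int f| <= K * 2.
Proof.
move=> df fK; rewrite -Int_exphalf -IntZ; last exact: exphalf_dom.
rewrite (le_trans (le_normr_Rintegral _ _))//; first exact: exp_dom_integrable.
apply: le_Rintegral => //.
- have [mf [L fL]] := df; apply: exp_dom_integrable; split.
    exact: measurableT_comp.
  by exists L => t t0; rewrite normr_id fL.
- by apply: exp_dom_integrable; apply: exp_domZ; exact: exphalf_dom.
- by move=> t /=; rewrite in_itv/= andbT => /ltW; exact: fK.
Qed.

Lemma Int_FTC (F f : R -> R) K l : {within `[0, +oo[, continuous f} ->
  exp_bounded f K -> (forall t, 0 < t -> is_derive t 1 F (f t)) ->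
  F t @[t --> +oo] --> l -> F t @[t --> 0^'+] --> F 0 -> Int f = l - F 0.
Proof.
move=> cf fK dF Fl F0.
have df := continuous_exp_dom cf fK.
have dE : exp_dominated (fun t => K * expR (- t / 2)).
  by apply: exp_domZ; exact: exphalf_dom.
(* Adding K e^(-t/2) makes the integrand nonnegative, as
   [ge0_continuous_FTC2y] requires. *)
have : Int (fun t => f t + K * expR (- t / 2)) =
    l - (F 0 - 2 * K * expR (- 0 / 2)).
  rewrite /Int /Rintegral itv0y_cbnd; last by have [] := exp_domD df dE.
  rewrite (@ge0_continuous_FTC2y _ _ (fun t => F t - 2 * K * expR (- t / 2)) _ l)//.
  - move=> t t0; have := fK _ t0; rewrite ler_norml => /andP[+ _].
    by rewrite -subr_ge0 opprK.
  - move=> t; apply: cvgD; first exact: cf.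
    by apply: cvgMr; apply: continuous_subspaceT; exact: continuous_exphalf.
  - rewrite -[X in _ --> X]subr0 -(mulr0 (2 * K)); apply: cvgB => //.
    by apply: cvgMr; exact: cvg_exphalf.
  - move=> t t0; have [? _] := dF t t0.
    by apply: derivableB => //; have [] := is_derive_exphalf (2 * K) t.
  - apply: cvgB => //.
    by apply: cvg_at_right_filter; apply: cvgMr; exact: continuous_exphalf.
  - move=> t; rewrite in_itv/= andbT => t0.
    have h1 := dF t t0; have h2 := is_derive_exphalf (2 * K) t.
    by rewrite derive1E derive_val /=; field.
rewrite IntD// IntZ; last exact: exphalf_dom.
rewrite Int_exphalf oppr0 mul0r expR0; lra.
Qed.

End half_line.

(** * Elementary inequalities for exponential, logarithm and powers *)

Section elementary_inequalities.
Variable R : realType.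
Implicit Types (u y : R).

Lemma expR_dist_le (p q M : R) : p <= M -> q <= M ->
  `|expR p - expR q| <= `|p - q| * expR M.
Proof.
wlog qp : p q / q <= p => [hw pM qM|pM qM].
  have [qp|/ltW pq] := leP q p; first exact: hw.
  by rewrite distrC [`|p - q|]distrC hw.
rewrite !ger0_norm ?subr_ge0 ?ler_expR//.
rewrite (@le_trans _ _ ((p - q) * expR p))//; last first.
  by rewrite ler_wpM2l ?subr_ge0 ?ler_expR.
have -> : expR q = expR (q - p) * expR p by rewrite -expRD subrK.
rewrite -[X in X - _]mul1r -mulrBl ler_wpM2r ?expR_ge0//.
by have := expR_ge1Dx (q - p); lra.
Qed.

Lemma norm_ln_le u : 0 < u -> `|ln u| <= u + u^-1.
Proof.
move=> u0; rewrite ler_norml; apply/andP; split.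
  have := expR_ge1Dx (- ln u); rewrite expRN lnK ?posrE// => h; lra.
have := expR_ge1Dx (ln u); rewrite lnK ?posrE// => h.
have : 0 < u^-1 by rewrite invr_gt0.
lra.
Qed.

(** The logarithm produced by varying the exponent is traded for u + 1/u, so the bound is a sum of
    pure powers with exponents shifted by 1 up or down. *)
Lemma powR_dist_le u p q : 0 < u ->
  `|u `^ p - u `^ q| <= `|p - q| * ((u + u^-1) * (u `^ p + u `^ q)).
Proof.
move=> u0; rewrite /powR gt_eqF//.
have e0 := expR_ge0; pose M := Num.max (p * ln u) (q * ln u).
apply: (@le_trans _ _ (`|p * ln u - q * ln u| * expR M)).
  by apply: expR_dist_le; rewrite /M le_max lexx ?orbT.
rewrite -mulrBl normrM -mulrA ler_wpM2l// ler_pM//.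
  exact: norm_ln_le.
rewrite /M; have := e0 _ (p * ln u); have := e0 _ (q * ln u).
by have [h|h] := leP (p * ln u) (q * ln u); lra.
Qed.

Lemma ge0_of_derive_ge0 (g dg : R -> R) y : (forall t : R, 0 <= t -> is_derive t 1 g (dg t)) ->
  (forall t : R, 0 <= t -> 0 <= dg t) -> g 0 = 0 -> 0 <= y -> 0 <= g y.
Proof.
move=> d d0 g0; rewrite le_eqVlt => /predU1P[<-|y0]; first by rewrite g0.
have [||c c0 e] := @MVT R g dg 0 y y0.
- by move=> t; rewrite in_itv/= => /andP[/ltW t0 _]; exact: d.
- apply: derivable_within_continuous => t; rewrite in_itv/= => /andP[t0 _].
  by have [] := d t t0.
move: c0; rewrite in_itv/= => /andP[/ltW c0 _].
have -> : g y = dg c * (y - 0) by rewrite -e g0 subr0.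
by rewrite mulr_ge0 ?d0// subr0 ltW.
Qed.

Lemma is_derive_ln1D y : 0 <= y -> is_derive y 1 (fun t : R => ln (1 + t)) (1 + y)^-1.
Proof.
move=> y0; have y1 : 0 < 1 + y by rewrite ltr_pwDl.
have h := is_derive1_ln y1.
have -> : (1 + y)^-1 = (1 + y)^-1 *: (1 : R) by rewrite /GRing.scale/= mulr1.
apply: is_derive1_comp.
by apply: is_derive_eq; rewrite add0r.
Qed.

Lemma ln1D_ge y : 0 <= y -> y - y ^+ 2 / 2 <= ln (1 + y).
Proof.
move=> y0; rewrite -subr_ge0.
apply: (@ge0_of_derive_ge0 (fun t => ln (1 + t) - (t - t ^+ 2 / 2))
  (fun t => t ^+ 2 / (1 + t))) => //.
- move=> t t0; have h := is_derive_ln1D t0; apply: is_derive_eq.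
  have t1 : 1 + t != 0 by rewrite gt_eqF// ltr_pwDl.
  by rewrite /GRing.scale/=; field.
- by move=> t t0; rewrite divr_ge0 ?sqr_ge0// addr_ge0.
- by rewrite addr0 ln1; ring.
Qed.

Lemma ln1D_le3 y : 0 <= y -> ln (1 + y) <= y - y ^+ 2 / 2 + y ^+ 3 / 3.
Proof.
move=> y0; rewrite -subr_ge0.
apply: (@ge0_of_derive_ge0 (fun t => t - t ^+ 2 / 2 + t ^+ 3 / 3 - ln (1 + t))
  (fun t => t ^+ 3 / (1 + t))); last exact: y0.
- move=> t t0; have h := is_derive_ln1D t0; apply: is_derive_eq.
  have t1 : 1 + t != 0 by rewrite gt_eqF// ltr_pwDl.
  by rewrite /GRing.scale/=; field.
- by move=> t t0; rewrite divr_ge0 ?exprn_ge0// addr_ge0.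
- by rewrite addr0 ln1; ring.
Qed.

(** Unlike a Taylor bound, this one is useful for all y: the gain over y is quadratic near 0 and
    still linear at infinity, which yields a majorant on the whole half-line in
    [charlier_exponent_le]. *)
Lemma ln1D_le y : 0 <= y -> ln (1 + y) <= y - y ^+ 2 / (2 * (1 + y)).
Proof.
move=> y0; rewrite -subr_ge0.
have y1 (t : R) : 0 <= t -> 1 + t != 0 by move=> t0; rewrite gt_eqF// ltr_pwDl.
have -> : y - y ^+ 2 / (2 * (1 + y)) - ln (1 + y) =
    y / 2 + 2^-1 - 2^-1 * (1 + y)^-1 - ln (1 + y).
  by field; exact: y1.
apply: (@ge0_of_derive_ge0 (fun t => t / 2 + 2^-1 - 2^-1 * (1 + t)^-1 - ln (1 + t))
  (fun t => t ^+ 2 / (2 * (1 + t) ^+ 2))); last exact: y0.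
- move=> t t0; have h := is_derive_ln1D t0.
  have t1 := y1 t t0.
  apply: is_derive_eq.
  by rewrite /GRing.scale/=; field.
- by move=> t t0; rewrite divr_ge0 ?sqr_ge0// mulr_ge0 ?sqr_ge0.
- by rewrite addr0 ln1 invr1; ring.
Qed.

End elementary_inequalities.

(** * The Gamma function *)

Section powers.
Variable R : realType.
Implicit Types (p t c : R).

(** For t > 1 the power is at most t^N with N the first integer above P, and t^N is bounded by one
    term of the series of e^(ct). The constant depends on P only, so the bound is uniform over p <=
    P. *)
Lemma powR_le_expR p P c : 0 <= p <= P -> 0 < c ->
  forall t, 0 <= t ->
  t `^ p <= (1 + (Num.truncn P).+1`!%:R / c ^+ (Num.truncn P).+1) * expR (c * t).
Proof.
move=> /andP[p0 pP] c0 t t0; set N := (Num.truncn P).+1.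
have PN : P <= N%:R.
  by rewrite ltW// /N truncnS_gt.
have K0 : 0 <= N`!%:R / c ^+ N :> R by rewrite divr_ge0// exprn_ge0// ltW.
have e1 : 1 <= expR (c * t) by rewrite -expR0 ler_expR mulr_ge0// ltW.
have [t1|t1] := leP t 1.
  rewrite (@le_trans _ _ 1)//.
    have : t `^ p <= 1 `^ p by rewrite ge0_ler_powR// nnegrE.
    by rewrite powR1.
  by rewrite (le_trans e1)// ler_peMl ?expR_ge0// lerDl.
rewrite (@le_trans _ _ (t ^+ N))//.
  by rewrite -powR_mulrn// ler_powR ?(ltW t1)// (le_trans pP).
have h := @expR_ge1Dxn R (c * t) (Num.truncn P) (mulr_ge0 (ltW c0) t0).
rewrite mulrDl mul1r.
have : t ^+ N <= N`!%:R / c ^+ N * expR (c * t).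
  have -> : t ^+ N = N`!%:R / c ^+ N * ((c * t) ^+ N / N`!%:R).
    rewrite exprMn; field.
    by rewrite expf_neq0 ?gt_eqF// ltr0n fact_gt0.
  by rewrite ler_wpM2l// (le_trans _ h)// lerDr.
by move=> /le_trans; apply; rewrite lerDr expR_ge0.
Qed.

Lemma cvg_powR0 p : 0 <= p -> t `^ p @[t --> (0 : R)^'+] --> (0 : R) `^ p.
Proof.
rewrite le_eqVlt => /predU1P[<-|p0].
  by under eq_fun do rewrite powRr0; rewrite powRr0; exact: cvg_cst.
by rewrite powR0 ?gt_eqF//; exact: powR_cvg0.
Qed.

Lemma continuous_powR p t : 0 < t -> {for t, continuous (fun u => u `^ p)}.
Proof.
move=> t0; apply/differentiable_continuous/derivable1_diffP.
by have [] := is_derive1_powR p t0.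
Qed.

Lemma within_continuous_powR p : 0 <= p ->
  {within `[(0 : R), +oo[, continuous (fun u => u `^ p)}.
Proof.
move=> p0; apply/continuous_within_itvcyP; split; last exact: cvg_powR0.
by move=> t; rewrite in_itv/= andbT => t0; exact: continuous_powR.
Qed.

Lemma within_continuousM (f g : R -> R) (A : set R) : {within A, continuous f} ->
  {within A, continuous g} -> {within A, continuous (fun t => f t * g t)}.
Proof. by move=> cf cg x; apply: cvgM; [exact: cf|exact: cg]. Qed.

Lemma within_continuous_expR (q : R -> R) : continuous q ->
  {within `[(0 : R), +oo[, continuous (fun u => expR (q u))}.
Proof.
move=> cq; apply: continuous_subspaceT => t.
by apply: continuous_comp; [exact: cq|exact: continuous_expR].
Qed.

Definition gamma_fun p t : R := t `^ p * expR (- t).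

Lemma within_continuous_gamma_fun p : 0 <= p ->
  {within `[(0 : R), +oo[, continuous (gamma_fun p)}.
Proof.
move=> p0; apply: within_continuousM; first exact: within_continuous_powR.
by apply: within_continuous_expR => t; exact: cvgN.
Qed.

Lemma gamma_fun_le p t : 0 <= p -> 0 <= t ->
  gamma_fun p t <= (1 + (Num.truncn p).+1`!%:R / 2^-1 ^+ (Num.truncn p).+1) * expR (- t / 2).
Proof.
move=> p0 t0; have c0 : 0 < 2^-1 :> R by rewrite invr_gt0.
have pp : 0 <= p <= p by rewrite p0 lexx.
rewrite /gamma_fun (_ : - t / 2 = 2^-1 * t - t); last by field.
by rewrite expRD mulrA ler_wpM2r ?expR_ge0// powR_le_expR.
Qed.

Lemma gamma_fun_ge0 p t : 0 <= gamma_fun p t.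
Proof. by rewrite mulr_ge0 ?powR_ge0 ?expR_ge0. Qed.

Lemma gamma_fun_bounded p : 0 <= p -> exists K, exp_bounded (gamma_fun p) K.
Proof.
move=> p0; eexists => t t0.
by rewrite ger0_norm ?gamma_fun_ge0//; exact: gamma_fun_le.
Qed.

Lemma gamma_fun_dom p : 0 <= p -> exp_dominated (gamma_fun p).
Proof.
move=> p0; have [K gK] := gamma_fun_bounded p0.
exact: continuous_exp_dom (within_continuous_gamma_fun p0) gK.
Qed.

Lemma euler_gammaE (z : R) : euler_gamma z = Int (gamma_fun (z - 1)).
Proof. by []. Qed.

Lemma cvg_gamma_fun p : 0 <= p -> gamma_fun p t @[t --> +oo] --> (0 : R).
Proof.
move=> p0; pose K := 1 + (Num.truncn p).+1`!%:R / 2^-1 ^+ (Num.truncn p).+1 : R.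
apply: (@squeeze_cvgr _ _ _ _ (cst 0) (fun t => K * expR (- t / 2))).
- apply: filterS (nbhs_pinfty_ge (num_real 0)) => t t0.
  by rewrite gamma_fun_ge0/= gamma_fun_le.
- exact: cvg_cst.
- by rewrite -[X in _ --> X](mulr0 K); apply: cvgMr; exact: cvg_exphalf.
Qed.

(** Integration by parts: the difference of the two integrands is the derivative of -t^z e^(-t),
    which vanishes at both ends. The condition 1 <= z keeps the integrands bounded at 0, as
    [exp_bounded] demands. *)
Lemma euler_gammaS (z : R) : 1 <= z -> euler_gamma (z + 1) = z * euler_gamma z.
Proof.
move=> z1; have z0 : 0 <= z by rewrite (le_trans _ z1).
have z10 : 0 <= z - 1 by rewrite subr_ge0.
rewrite !euler_gammaE addrK; apply/eqP; rewrite -subr_eq0; apply/eqP.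
rewrite -IntZ; last exact: gamma_fun_dom.
rewrite -IntB; [|exact: gamma_fun_dom|by apply: exp_domZ; exact: gamma_fun_dom].
have [_ [K fK]] : exp_dominated (fun t => gamma_fun z t - z * gamma_fun (z - 1) t).
  by apply: exp_domB; [|apply: exp_domZ]; exact: gamma_fun_dom.
transitivity (0 - (- gamma_fun z 0)); last first.
  have zn0 : z != 0 by rewrite gt_eqF// (lt_le_trans ltr01 z1).
  by rewrite /gamma_fun (powR0 zn0) mul0r !oppr0 addr0.
apply: (@Int_FTC _ (fun t => - gamma_fun z t) _ K 0) => //.
- move=> t; apply: cvgB; first exact: within_continuous_gamma_fun.
  by apply: cvgMr; exact: within_continuous_gamma_fun.
- move=> t t0; have d := is_derive1_powR z t0.
  apply: is_derive_eq.
  by rewrite /gamma_fun /GRing.scale/=; ring.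
- by rewrite -[X in _ --> X]oppr0; apply: cvgN; exact: cvg_gamma_fun.
- apply: cvgN; apply: cvgM; first exact: cvg_powR0.
  apply: cvg_at_right_filter; apply: continuous_comp; last exact: continuous_expR.
  exact: cvgN.
Qed.

Lemma Int_gt0 (f : R -> R) k : exp_dominated f -> (forall t, 0 < t -> 0 <= f t) ->
  0 < k -> (forall t, 1 <= t <= 2 -> k <= f t) -> 0 < Int f.
Proof.
move=> df f0 k0 fk; rewrite (lt_le_trans k0)// -lee_fin.
have [mf _] := df.
have -> : (Int f)%:E = (\int[lebesgue_measure]_(t in `](0 : R)%R, +oo[) (f t)%:E)%E.
  by rewrite fineK//; apply: integrable_fin_num => //; exact: exp_dom_integrable.
have sub : `[(1 : R), 2] `<=` `](0 : R), +oo[.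
  by move=> t /=; rewrite !in_itv/= andbT => /andP[t1 _]; rewrite (lt_le_trans _ t1).
apply: (@le_trans _ _ (\int[lebesgue_measure]_(t in `[(1 : R)%R, 2%R]) (f t)%:E)%E).
  apply: (@le_trans _ _ (\int[lebesgue_measure]_(t in `[(1 : R)%R, 2%R]) k%:E)%E).
    rewrite integral_cst//= lebesgue_measure_itv/= lte_fin ltr1n.
    by rewrite -EFinD -EFinM lee_fin; lra.
  apply: ge0_le_integral => //.
  - by move=> t _; rewrite lee_fin ltW.
  - by apply/measurable_EFinP; exact: measurable_funS mf.
apply: ge0_subset_integral => //.
- exact/measurable_EFinP.
- by move=> t /=; rewrite in_itv/= andbT => t0; rewrite lee_fin f0.
Qed.

Lemma euler_gamma_gt0 (z : R) : 1 <= z -> 0 < euler_gamma z.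
Proof.
move=> z1; rewrite euler_gammaE.
have z10 : 0 <= z - 1 by rewrite subr_ge0.
apply: (@Int_gt0 _ (expR (- 2))) => //; first exact: gamma_fun_dom.
- by move=> t _; exact: gamma_fun_ge0.
- move=> t /andP[t1 t2]; rewrite -[leLHS]mul1r ler_pM ?expR_ge0//.
    by rewrite -[leLHS](powRr0 t) ler_powR.
  by rewrite ler_expR lerN2.
Qed.

Lemma euler_gammaD (s : R) k : 1 <= s ->
  euler_gamma (s + k%:R) = rising_fact s k * euler_gamma s.
Proof.
move=> s1; elim: k => [|k IH]; first by rewrite addr0 /rising_fact big_ord0 mul1r.
rewrite -natr1 addrA euler_gammaS ?IH ?ler_wpDr//.
by rewrite /rising_fact big_ord_recr/= mulrA [(s + _) * _]mulrC.
Qed.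

End powers.

(** * Change of variables on the half-line *)

Section substitution.
Variable R : realType.
Local Notation mu := (@lebesgue_measure R).
Implicit Types (f F : R -> R).

(** Monotone convergence along an exhaustion. [Int_substitution] applies it with b n = F(n) and with
    b n = n, passing to the limit on both sides of the substitution over [0, n]. *)
Lemma cvg_integral_0y (f : R -> R) (b : nat -> R) :
  measurable_fun `[(0 : R), +oo[ f -> (forall t, 0 <= t -> 0 <= f t) ->
  {homo b : m n / (m <= n)%N >-> m <= n} -> (forall t, exists n, t <= b n) ->
  (\int[mu]_(t in `[0%R, b n]) (f t)%:E)%E @[n --> \oo] -->
  (\int[mu]_(t in `[(0 : R)%R, +oo[) (f t)%:E)%E.
Proof.
move=> mf f0 bn bt.
have sub n : `[0, b n] `<=` `[(0 : R), +oo[.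
  by move=> t /=; rewrite !in_itv/= andbT => /andP[].
have -> : `[(0 : R), +oo[%classic = \bigcup_n `[0, b n]%classic.
  apply/seteqP; split=> [t /=|t [n _]]; last exact: sub.
  rewrite in_itv/= andbT => t0; have [n tn] := bt t.
  by exists n => //=; rewrite in_itv/= t0.
apply: ge0_nondecreasing_set_cvg_integral => //.
- move=> m n mn; rewrite subsetEset => t /=; rewrite !in_itv/= => /andP[-> /le_trans].
  by apply; exact: bn.
- move=> n; apply/measurable_EFinP; exact: measurable_funS (sub n) mf.
- by move=> n t /sub /=; rewrite in_itv/= andbT lee_fin; exact: f0.
Qed.

(* Unlike the library's substitution lemma, this allows the derivative of F to be
   unbounded at infinity. *)
Lemma Int_substitution F f :
  (forall x, derivable F x 1) -> continuous F^`()%classic -> F 0 = 0 ->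
  {in `[0, +oo[ &, {homo F : x y / x < y}} -> (forall t, exists n : nat, t <= F n%:R) ->
  {within `[0, +oo[, continuous f} -> (forall t, 0 <= t -> 0 <= f t) ->
  measurable_fun `[(0 : R), +oo[ (fun t => f (F t) * F^`()%classic t) ->
  (forall t, 0 <= t -> 0 <= f (F t) * F^`()%classic t) ->
  Int f = Int (fun t => f (F t) * F^`()%classic t).
Proof.
move=> dF cF' F0 incF Fy cf f0 mg g0.
have mf : measurable_fun `[(0 : R), +oo[ f by exact: subspace_continuous_measurable_fun.
have sub : `](0 : R), +oo[ `<=` `[(0 : R), +oo[.
  by move=> t /=; rewrite !in_itv/= !andbT => /ltW.
have sub' m : measurable_fun `[(0 : R), +oo[ m -> measurable_fun `](0 : R), +oo[ m.
  exact: measurable_funS.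
have ndF : {homo (fun n : nat => F n%:R) : m n / (m <= n)%N >-> m <= n}.
  move=> m n; rewrite leq_eqVlt => /predU1P[->//|mn].
  by apply/ltW/incF; rewrite ?in_itv/= ?andbT// ltr_nat.
have h1 := cvg_integral_0y mf f0 ndF Fy.
have ndn : {homo (fun n : nat => n%:R : R) : m n / (m <= n)%N >-> m <= n}.
  by move=> m n; rewrite ler_nat.
have bn (t : R) : exists n : nat, t <= n%:R.
  by exists (Num.bound `|t|); apply/ltW; rewrite (le_lt_trans (ler_norm t))// archi_boundP.
have h2 := cvg_integral_0y mg g0 ndn bn.
rewrite /Int /Rintegral !itv0y_cbnd//; [|exact: sub'..]; congr fine.
apply: cvg_unique h1 _ => //.
apply: cvg_trans h2; apply: near_eq_cvg; apply: nearW => n.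
have cF x : {for x, continuous F} by apply/differentiable_continuous/derivable1_diffP.
have := @integration_by_substitution_increasing _ F f 0 n%:R (ler0n _ _).
rewrite F0 => ->//.
- by move=> x y; rewrite !in_itv/= => /andP[x0 _] /andP[y0 _]; apply: incF; rewrite in_itv/= ?x0 ?y0.
- by apply: (cvgP (F^`()%classic 0)); apply: cvg_at_right_filter; exact: (cF' 0).
- by apply: (cvgP (F^`()%classic n%:R)); apply: cvg_at_left_filter; exact: (cF' n%:R).
- by split => //; [apply: cvg_at_right_filter|apply: cvg_at_left_filter]; exact: cF.
- apply: continuous_subspaceW cf => t /=; rewrite !in_itv/= andbT => /andP[]//.
Qed.

Lemma Int_scale f c : 0 < c -> {within `[0, +oo[, continuous f} ->
  (forall t, 0 <= t -> 0 <= f t) ->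
  {within `[0, +oo[, continuous (fun t => f (c * t))} ->
  Int f = Int (fun t => c * f (c * t)).
Proof.
move=> c0 cf f0 cfc.
have dE : (fun t : R => c * t)^`()%classic = cst c.
  by apply/funext => t; rewrite derive1Ml// derive1_id mulr1.
rewrite (@Int_substitution (fun t => c * t) f)//.
- by apply: eq_Int => t _; rewrite dE mulrC.
- by rewrite dE => t; exact: cvg_cst.
- by rewrite mulr0.
- by move=> x y _ _; rewrite ltr_pM2l.
- move=> t; exists (Num.bound `|t / c|); rewrite mulrC -ler_pdivrMr//.
  by rewrite ltW// (le_lt_trans (ler_norm _))// archi_boundP.
- rewrite dE; apply: subspace_continuous_measurable_fun => //.
  by apply: within_continuousM => // x; exact: cvg_cst.
- by move=> t t0; rewrite dE mulr_ge0 ?f0// ?mulr_ge0// ltW.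
Qed.

Lemma Int_sqr f : {within `[0, +oo[, continuous f} ->
  (forall t, 0 <= t -> 0 <= f t) ->
  {within `[0, +oo[, continuous (fun t => f (t ^+ 2))} ->
  Int f = Int (fun t => f (t ^+ 2) * (2 * t)).
Proof.
move=> cf f0 cfc.
have dE : (fun t : R => t ^+ 2)^`()%classic = (fun t => 2 * t).
  by apply/funext => t; rewrite exp_derive1 expr1.
rewrite (@Int_substitution (fun t => t ^+ 2) f)//.
- by apply: eq_Int => t _; rewrite dE.
- by rewrite dE => t; apply: cvgMr; exact: cvg_id.
- by rewrite expr0n.
- move=> x y; rewrite !in_itv/= !andbT => x0 y0 xy.
  by rewrite ltr_pXn2r.
- move=> t; exists (Num.bound `|t|).+1; rewrite (@le_trans _ _ (Num.bound `|t|).+1%:R)//.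
    by rewrite -natr1 ler_wpDr// (le_trans (ler_norm t))// ltW// archi_boundP.
  by rewrite expr2 ler_peMl// ler1n.
- rewrite dE; apply: subspace_continuous_measurable_fun => //.
  apply: within_continuousM => //; apply: continuous_subspaceT => t.
  by apply: cvgMr; exact: cvg_id.
- by move=> t t0; rewrite dE mulr_ge0 ?f0// ?sqr_ge0// mulr_ge0.
Qed.

End substitution.

Definition fallf (R : realType) (z : R) (k : nat) : R := \prod_(i < k) (z - i%:R).

(** * Recurrences for Charlier polynomials *)

Section charlier_algebra.
Variable R : realType.
Implicit Types (a z : R) (n k : nat).

Lemma fallfS z k : fallf z k.+1 = fallf z k * (z - k%:R).
Proof. by rewrite /fallf big_ord_recr. Qed.

Lemma fallfSl z k : fallf z k.+1 = z * fallf (z - 1) k.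
Proof.
rewrite /fallf big_ord_recl subr0; congr (_ * _); apply: eq_bigr => i _.
by rewrite lift0 -addn1 natrD; ring.
Qed.

Lemma charlierE a n z :
  charlier a n z = \sum_(k < n.+1) 'C(n, k)%:R * fallf z k * (- a) ^- k.
Proof.
apply: eq_bigr => k _; rewrite /gen_binom -/(fallf z k); congr (_ * _).
rewrite -mulrA; congr (_ * _); by rewrite divfK// pnatr_eq0 -lt0n fact_gt0.
Qed.

Lemma charlierEw a n m z : (n < m)%N ->
  charlier a n z = \sum_(k < m) 'C(n, k)%:R * fallf z k * (- a) ^- k.
Proof.
move=> nm; rewrite charlierE (big_ord_widen m (fun k => 'C(n, k)%:R * fallf z k * (- a) ^- k))//.
rewrite big_mkcond; apply: eq_bigr => k _; case: ifPn => //.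
by rewrite -leqNgt => nk; rewrite bin_small// !mul0r.
Qed.

Lemma charlierSn a n z : a != 0 ->
  charlier a n.+1 z - charlier a n z = - (z / a) * charlier a n (z - 1).
Proof.
move=> a0; rewrite charlierE (@charlierEw _ _ n.+2)// -sumrB big_ord_recl.
rewrite !bin0 subrr add0r charlierE mulr_sumr; apply: eq_bigr => k _.
rewrite lift0 binS natrD fallfSl exprS invfM invrN.
by move: (_ ^- k) => q; field.
Qed.

Lemma charlierSz a n z : a != 0 ->
  charlier a n.+1 (z + 1) - charlier a n.+1 z = - (n.+1%:R / a) * charlier a n z.
Proof.
move=> a0; rewrite !charlierE -sumrB big_ord_recl.
rewrite /fallf !big_ord0 subrr add0r mulr_sumr; apply: eq_bigr => k _.
rewrite -!/(fallf _ _) lift0 fallfSl fallfS addrK exprS invfM.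
have := mul_bin_diag n.+1 k => /(congr1 (fun m => m%:R : R)); rewrite !natrM => h.
transitivity ((k.+1%:R * 'C(n.+1, k.+1)%:R) * fallf z k * (- a^-1 * (- a) ^- k)).
  case: k h => k /= _ _; move: (_ ^- k) => q.
  by rewrite invrN -[k.+1%:R]natr1; ring.
by rewrite -h; move: (_ ^- k) => q; field.
Qed.

(** For positive degree n+1, the two first-order relations express every value involved through
    c_(n+1)(z) and c_n(z-1), and the recurrence becomes a rational identity. *)
Lemma charlier_rec_z a n z : a != 0 ->
  a * charlier a n (z + 1) = (z + a - n%:R) * charlier a n z - z * charlier a n (z - 1).
Proof.
move=> a0; case: n => [|n].
  by rewrite !charlierE !big_ord1 bin0 /fallf !big_ord0 expr0 invr1; ring.
have h1 := charlierSz n z a0.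
have h2 := charlierSz n (z - 1) a0; rewrite subrK in h2.
have h3 := charlierSn n z a0.
have e1 : charlier a n.+1 (z + 1) = charlier a n.+1 z - (n.+1%:R / a) * charlier a n z.
  by rewrite -mulNr -h1; ring.
have e2 : charlier a n.+1 (z - 1) = charlier a n.+1 z + (n.+1%:R / a) * charlier a n (z - 1).
  by rewrite -[LHS](subKr (charlier a n.+1 z)) h2; ring.
have e3 : charlier a n z = charlier a n.+1 z + (z / a) * charlier a n (z - 1).
  by rewrite -[LHS](subKr (charlier a n.+1 z)) h3; ring.
by rewrite e1 e2 e3; field.
Qed.

(** Written as a birth-death operator in n, which is symmetric for the weights a^k/k!; this symmetry
    drives the telescoping in [charlier_wronskian]. At n = 0 the last difference is multiplied by
    0. *)
Lemma charlier_rec_n a n z : a != 0 ->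
  - z * charlier a n z =
  a * (charlier a n.+1 z - charlier a n z)
  - n%:R * (charlier a n z - charlier a n.-1 z).
Proof.
move=> a0; rewrite charlierSn//; case: n => [|n] /=.
  by rewrite !charlierE !big_ord1 bin0 /fallf !big_ord0 expr0 invr1 /=; field.
rewrite charlierSn//; have h2 := charlierSz n (z - 1) a0; rewrite subrK in h2.
have -> : charlier a n.+1 z = charlier a n.+1 (z - 1) - (n.+1%:R / a) * charlier a n (z - 1).
  by rewrite -mulNr -h2; ring.
by field.
Qed.

Lemma fallf_rising a s k : fallf (- s) k * (- a) ^- k = rising_fact s k * a ^- k.
Proof.
elim: k => [|k IH]; first by rewrite /fallf /rising_fact !big_ord0.
rewrite fallfS /rising_fact big_ord_recr -/(rising_fact s k) !exprSr !invfM invrN.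
move: IH; rewrite /fallf /rising_fact; move: (\prod_(_ < _) _) (\prod_(_ < _) _).
move: ((- a) ^- k) (a ^- k) => p q v u h.
transitivity (- a^-1 * (- s - k%:R) * (u * p)); first by rewrite /=; ring.
by rewrite h /=; ring.
Qed.

Lemma charlier_neg a n s : charlier a n (- s) =
  \sum_(k < n.+1) 'C(n, k)%:R * (rising_fact s k * a ^- k).
Proof.
by rewrite charlierE; apply: eq_bigr => k _; rewrite -mulrA fallf_rising.
Qed.

(** At z = -s with s >= 0 every summand is nonnegative and the first one is 1. Real zeros are
    therefore positive, and limits of zeros nonnegative. *)
Lemma charlier_gt0 a n z : 0 < a -> z <= 0 -> 0 < charlier a n z.
Proof.
move=> a0 z0; rewrite -[z]opprK charlier_neg big_ord_recl.
rewrite bin0 /rising_fact big_ord0 expr0 invr1 !mulr1 ltr_pwDl//.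
apply: sumr_ge0 => k _; rewrite !mulr_ge0 ?invr_ge0 ?exprn_ge0 ?(ltW a0)//.
by apply: prodr_ge0 => i _; rewrite addr_ge0// oppr_ge0.
Qed.

(* A polynomial form of [charlier a n], so that its recurrences can be
   differentiated formally. *)
Definition charlier_poly a n : {poly R} :=
  \sum_(k < n.+1) ('C(n, k)%:R * (- a) ^- k) *: \prod_(i < k) ('X - i%:R%:P).

Lemma horner_charlier_poly a n z : (charlier_poly a n).[z] = charlier a n z.
Proof.
rewrite charlierE horner_sum; apply: eq_bigr => k _.
rewrite hornerZ horner_prod mulrAC; congr (_ * _ * _).
by apply: eq_bigr => i _; rewrite !hornerE.
Qed.

Lemma poly_fun0 (p : {poly R}) : (forall z, p.[z] = 0) -> p = 0.
Proof.
move=> p0; apply: contraTeq isT => pn0.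
have := @max_poly_roots _ p [seq i%:R | i <- iota 0 (size p)] pn0.
rewrite size_map size_iota ltnn; apply.
  by apply/allP => y _; rewrite /root p0.
by rewrite map_inj_uniq ?iota_uniq// => i j /eqP; rewrite eqr_nat => /eqP.
Qed.

Lemma charlier_poly_rec_n a n : a != 0 ->
  - ('X * charlier_poly a n) =
  a *: (charlier_poly a n.+1 - charlier_poly a n)
  - n%:R *: (charlier_poly a n - charlier_poly a n.-1).
Proof.
move=> a0; apply/eqP; rewrite -subr_eq0; apply/eqP; apply: poly_fun0 => z.
rewrite !(hornerD, hornerN, hornerZ, hornerM, hornerX, horner_charlier_poly).
by have := charlier_rec_n n z a0 => h; apply/eqP; rewrite subr_eq0 -mulNr h.
Qed.

Definition dcharlier a n z := (charlier_poly a n)^`().[z].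

Lemma is_derive_charlier a n z : is_derive z 1 (charlier a n) (dcharlier a n z).
Proof.
have -> : charlier a n = horner (charlier_poly a n).
  by apply/funext => y; rewrite horner_charlier_poly.
exact: is_derive_poly.
Qed.

Lemma dcharlier_rec_n a n z : a != 0 ->
  - charlier a n z - z * dcharlier a n z =
  a * (dcharlier a n.+1 z - dcharlier a n z)
  - n%:R * (dcharlier a n z - dcharlier a n.-1 z).
Proof.
move=> a0; have := congr1 (fun p => p^`().[z]) (charlier_poly_rec_n n a0).
rewrite !(derivN, derivB, derivM, derivZ, derivX).
rewrite !(hornerD, hornerN, hornerZ, hornerM, hornerX, hornerC).
by rewrite horner_charlier_poly mul1r opprD => ->.
Qed.

(* The confluent Christoffel--Darboux identity for the Poisson weights. *)
Lemma charlier_wronskian a n z : a != 0 ->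
  \sum_(k < n.+1) a ^+ k / k`!%:R * charlier a k z ^+ 2 =
  a ^+ n.+1 / n`!%:R *
  (charlier a n.+1 z * dcharlier a n z - dcharlier a n.+1 z * charlier a n z).
Proof.
move=> a0; elim: n => [|n IH].
  rewrite big_ord1 expr0 fact0.
  have := dcharlier_rec_n 0 z a0; have := charlier_rec_n 0 z a0 => /=.
  rewrite !mul0r !subr0 => h1 h2.
  have d0 : dcharlier a 0 z = 0.
    rewrite /dcharlier /charlier_poly big_ord1 big_ord0.
    by rewrite -mul_polyC mulr1 derivC horner0.
  have c0 : charlier a 0 z = 1.
    by rewrite charlierE big_ord1 /fallf big_ord0 bin0 expr0 invr1 !mulr1.
  have e2 : a * dcharlier a 1 z = - 1.
    by move: h2; rewrite d0 c0 !(mulr0, subr0) => ->.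
  rewrite d0 c0 expr1; transitivity (- (a * dcharlier a 1 z)); last by field.
  by rewrite e2; field.
rewrite big_ord_recr IH /=.
have h1 := charlier_rec_n n.+1 z a0; have h2 := dcharlier_rec_n n.+1 z a0.
move: h1 h2 => /=; set c0 := charlier a n z; set c1 := charlier a n.+1 z.
set c2 := charlier a n.+2 z; set d0 := dcharlier a n z.
set d1 := dcharlier a n.+1 z; set d2 := dcharlier a n.+2 z => h1 h2.
have e1 : a * c2 = - z * c1 + a * c1 + n.+1%:R * (c1 - c0) by rewrite h1; ring.
have e2 : a * d2 = - c1 - z * d1 + a * d1 + n.+1%:R * (d1 - d0).
  by rewrite h2; ring.
have n0 : n`!%:R != 0 :> R by rewrite pnatr_eq0 -lt0n fact_gt0.
rewrite [a ^+ n.+2]exprSr factS natrM.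
transitivity (a ^+ n.+1 / (n.+1%:R * n`!%:R) * ((a * c2) * d1 - (a * d2) * c1)); last first.
  by ring.
have n1 : 1 + n%:R != 0 :> R by rewrite nat1r pnatr_eq0.
by rewrite e1 e2 -nat1r; field; rewrite n0.
Qed.

End charlier_algebra.

(** * Recurrences for the Hermite function *)

Section kummer.
Variable R : realType.
Implicit Types (a b z : R) (k n : nat).

Lemma rising_factS a k : rising_fact a k.+1 = rising_fact a k * (a + k%:R).
Proof. by rewrite /rising_fact big_ord_recr. Qed.

Lemma rising_factSl a k : rising_fact a k.+1 = a * rising_fact (a + 1) k.
Proof.
rewrite /rising_fact big_ord_recl addr0; congr (_ * _); apply: eq_bigr => i _.
by rewrite lift0 -natr1; ring.
Qed.

Lemma rising_fact_gt0 b k : 0 < b -> 0 < rising_fact b k.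
Proof. by move=> b0; apply: prodr_gt0 => i _; rewrite ltr_wpDr. Qed.

Definition kummer_coef a b k := rising_fact a k / (rising_fact b k * k`!%:R).

(** Each factor |a + k|/(b + k) is at most L = |a|/b + 1, so the series is dominated by that of
    exp(L|z|). *)
Lemma is_cvg_kummer a b z : 0 < b -> cvgn (pseries (kummer_coef a b) z).
Proof.
move=> b0; pose L := `|a| / b + 1.
have L0 : 0 <= L by rewrite addr_ge0// divr_ge0// ltW.
have rL k : `|rising_fact a k| / rising_fact b k <= L ^+ k.
  elim: k => [|k IH]; first by rewrite /rising_fact !big_ord0 normr1 divr1 expr0.
  rewrite !rising_factS normrM invfM mulrACA exprSr ler_pM//.
  - by rewrite divr_ge0// ltW// rising_fact_gt0.
  - by rewrite divr_ge0// ltW// ltr_wpDr.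
  - rewrite ler_pdivrMr ?ltr_wpDr// (le_trans (ler_normD _ _))// normr_nat.
    rewrite /L !mulrDl !mulrDr divfK ?gt_eqF// mul1r lerD//.
      by rewrite lerDl mulr_ge0// divr_ge0// ltW.
    by rewrite mul1r lerDr ltW.
apply: normed_cvg.
apply: (@series_le_cvg _ _ (exp_coeff (L * `|z|))).
- by move=> k /=; rewrite normr_ge0.
- by move=> k; apply: exp_coeff_ge0; rewrite mulr_ge0.
- move=> k; rewrite /kummer_coef /exp_coeff /= normrM normrX normrM normfV.
  rewrite exprMn [leRHS]mulrAC ler_wpM2r//.
  rewrite normrM normr_nat [`|rising_fact b k|]gtr0_norm ?rising_fact_gt0//.
  by rewrite invfM mulrA ler_wpM2r ?invr_ge0.
- exact: is_cvg_series_exp_coeff.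
Qed.

Lemma kummerMP a b z : 0 < b ->
  pseries (kummer_coef a b) z @ \oo --> kummerM a b z.
Proof. by move=> b0; exact: is_cvg_kummer. Qed.

Lemma kummerM0 b z : kummerM 0 b z = 1.
Proof.
rewrite /kummerM; apply/cvg_lim => //.
apply: cvg_near_cst; near=> n.
have [m ->] : exists m, n = m.+1.
  by exists n.-1; rewrite prednK//; near: n; exact: nbhs_infty_gt.
rewrite /pseries /series /= big_nat_recl//= big1 => [|i _].
  by rewrite /rising_fact !big_ord0 fact0 expr0 !mulr1 divr1 addr0.
by rewrite rising_factSl !mul0r.
Unshelve. all: by end_near. Qed.

(** The identity holds coefficient by coefficient, so the combined partial sums are all 0. It
    handles one of the two parities in x of the Hermite recurrence; [kummerM_contiga] handles the
    other. *)
Lemma kummerM_contigb a b z : 1 < b ->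
  (b - 1 - a) * kummerM a b z - (b - 1) * kummerM a (b - 1) z
  + a * kummerM (a + 1) b z = 0.
Proof.
move=> b1; have b0 : 0 < b by rewrite (lt_trans _ b1).
have b10 : 0 < b - 1 by rewrite subr_gt0.
apply: (@cvg_unique _ _ ((fun n => (b - 1 - a) * pseries (kummer_coef a b) z n -
  (b - 1) * pseries (kummer_coef a (b - 1)) z n +
  a * pseries (kummer_coef (a + 1) b) z n) @ \oo)) => //.
  by apply: cvgD; [apply: cvgB|]; apply: cvgMr; exact: kummerMP.
apply: cvg_near_cst; apply: nearW => n.
rewrite /pseries /series /= !mulr_sumr -sumrB -big_split/= big1// => k _.
have fk : k`!%:R != 0 :> R by rewrite pnatr_eq0 -lt0n fact_gt0.
have rb := lt0r_neq0 (rising_fact_gt0 k b0).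
have rb1 := lt0r_neq0 (rising_fact_gt0 k b10).
have e1 : rising_fact (b - 1) k * (b - 1 + k%:R) = (b - 1) * rising_fact b k.
  by rewrite -rising_factS rising_factSl subrK.
have e2 : a * rising_fact (a + 1) k = rising_fact a k * (a + k%:R).
  by rewrite -rising_factS rising_factSl.
have b1k : b - 1 + k%:R != 0 by rewrite gt_eqF// ltr_wpDr.
have e3 : rising_fact (b - 1) k = (b - 1) * rising_fact b k / (b - 1 + k%:R).
  by rewrite -e1 mulfK.
rewrite /kummer_coef mulrA [X in _ + X]mulrA [a * _]mulrA e2 e3.
by field; rewrite fk rb b1k gt_eqF.
Qed.

(** The constant terms cancel and the rest, shifted by one index, is the series on the right; hence
    partial sums at [n.+1] are compared with those at [n]. *)
Lemma kummerM_contiga a b z : 0 < b ->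
  kummerM (a + 1) b z - kummerM a b z = z / b * kummerM (a + 1) (b + 1) z.
Proof.
move=> b0; have b10 : 0 < b + 1 by rewrite addr_gt0.
apply: (@cvg_unique _ _ ((fun n => pseries (kummer_coef (a + 1) b) z n.+1 -
  pseries (kummer_coef a b) z n.+1) @ \oo)) => //.
  by apply: cvgB; rewrite cvg_shiftS; exact: kummerMP.
have -> : (fun n => pseries (kummer_coef (a + 1) b) z n.+1 -
  pseries (kummer_coef a b) z n.+1) =
  (fun n => z / b * pseries (kummer_coef (a + 1) (b + 1)) z n).
  apply/funext => n; rewrite /pseries /series /= -sumrB big_nat_recl//=.
  rewrite {1 2}/kummer_coef /rising_fact !big_ord0 subrr add0r mulr_sumr.
  apply: eq_bigr => k _; rewrite /kummer_coef -!/(rising_fact _ _).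
  have fk : k`!%:R != 0 :> R by rewrite pnatr_eq0 -lt0n fact_gt0.
  have rb := lt0r_neq0 (rising_fact_gt0 k b10).
  have k1 : 1 + k%:R != 0 :> R by rewrite nat1r pnatr_eq0.
  rewrite factS natrM exprS rising_factS !rising_factSl -nat1r.
  by field; rewrite fk rb k1 gt_eqF.
by apply: cvgMr; exact: kummerMP.
Qed.

End kummer.

Section hermite_rec.
Variable R : realType.
Implicit Types (z nu x : R).

(** By the functional equation, raising an admissible m by one leaves the quotient unchanged; two
    admissible values are then compared through their sum. *)
Lemma inv_gammaE z m : 1 <= z + m%:R ->
  inv_gamma z = rising_fact z m / euler_gamma (z + m%:R).
Proof.
have step k : 1 <= z + k%:R -> rising_fact z k / euler_gamma (z + k%:R) =
    rising_fact z k.+1 / euler_gamma (z + k.+1%:R).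
  move=> zk; rewrite rising_factS -natr1 addrA euler_gammaS//; field.
  by rewrite (gt_eqF (euler_gamma_gt0 zk)) gt_eqF// (lt_le_trans _ zk).
have stepn k j : 1 <= z + k%:R -> rising_fact z k / euler_gamma (z + k%:R) =
    rising_fact z (k + j) / euler_gamma (z + (k + j)%:R).
  move=> zk; elim: j => [|j ->]; first by rewrite addn0.
  by rewrite step ?addnS// (le_trans zk)// lerD2l ler_nat leq_addr.
have zm0 : 1 <= z + `|Num.floor z|%N.+1%:R.
  have h : (- `|Num.floor z|%N%:R : R) <= (Num.floor z)%:~R.
    by rewrite natr_absz lerNl -mulrNz ler_int; lia.
  by rewrite -natr1 addrA lerDr addrC -lerBlDl sub0r (le_trans h)// floor_le.
move=> zm; rewrite /inv_gamma; move: (_.+1) zm0 => k zk.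
by rewrite (stepn k m zk) addnC -(stepn m k zm).
Qed.

Lemma inv_gammaS z : inv_gamma z = z * inv_gamma (z + 1).
Proof.
have [m zm] : exists m, 1 <= z + 1 + m%:R.
  exists (Num.bound `|z|); have := archi_boundP (normr_ge0 z).
  have := ler_norm (- z); rewrite normrN; lra.
rewrite (@inv_gammaE z m.+1) ?(@inv_gammaE (z + 1) m)//.
  by rewrite rising_factSl mulrA -[m.+1%:R]nat1r addrA.
by rewrite -nat1r addrA.
Qed.

Lemma inv_gamma_ge1 z : 1 <= z -> inv_gamma z = (euler_gamma z)^-1.
Proof.
by move=> z1; rewrite (@inv_gammaE z 0) addr0// /rising_fact big_ord0 mul1r.
Qed.

Lemma hermiteS nu x :
  hermite (nu + 1) x = 2 * x * hermite nu x - 2 * nu * hermite (nu - 1) x.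
Proof.
rewrite /hermite.
have p1 : 2 `^ (nu + 1) = 2 * 2 `^ nu :> R.
  by rewrite powRD ?powRr1 1?mulrC// pnatr_eq0 implybT.
have p2 : 2 `^ (nu - 1) = 2 `^ nu / 2 :> R.
  by rewrite powRB ?powRr1// pnatr_eq0 implybT.
set A := inv_gamma ((1 - nu) / 2); set B := inv_gamma (- nu / 2).
have -> : (1 - (nu + 1)) / 2 = - nu / 2 :> R by field.
have -> : (1 - (nu - 1)) / 2 = - nu / 2 + 1 :> R by field.
have -> : - (nu - 1) / 2 = (1 - nu) / 2 :> R by field.
have -> : inv_gamma (- (nu + 1) / 2) = - (nu + 1) / 2 * A.
  by rewrite inv_gammaS; congr (_ * inv_gamma _); field.
(* Kept multiplied by nu, so that nu = 0 is covered without a division. *)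
have hB : nu * inv_gamma (- nu / 2 + 1) = - 2 * B.
  by rewrite /B [in RHS]inv_gammaS; field.
have c1 := @kummerM_contigb _ (- nu / 2) (3 / 2) (x ^+ 2) _.
have c2 := @kummerM_contiga _ (- (nu + 1) / 2) (1 / 2) (x ^+ 2) _.
have e1 : 3 / 2 - 1 = 1 / 2 :> R by field.
have e2 : - (nu + 1) / 2 + 1 = (1 - nu) / 2 :> R by field.
have e3 : 1 / 2 + 1 = 3 / 2 :> R by field.
rewrite e1 in c1; rewrite e2 e3 in c2.
have {}c1 := c1 ltac:(lra); have {}c2 := c2 ltac:(lra).
rewrite p1 p2.
move: (inv_gamma (- nu / 2 + 1)) hB => C hB.
move: c1 c2.
move: (kummerM _ _ _) => M1; move: (kummerM _ _ _) => M2.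
move: (kummerM _ _ _) => M3; move: (kummerM _ _ _) => M4.
move: (kummerM _ _ _) => M5; move: (kummerM _ _ _) => M6 c1 c2.
have -> : M2 = (1 + nu) * M1 - nu * M3.
  apply/eqP; rewrite -subr_eq0 -(mulr0 (- 2)) -c1; apply/eqP; by field.
have -> : M5 = M4 - 2 * x ^+ 2 * M6.
  by rewrite -[LHS](subKr M4) c2; field.
rewrite -/A -/B; clearbody A B; move: (2 `^ nu) (Num.sqrt pi) => p s.
transitivity (2 * x * (p * s * (A * ((1 + nu) * M1 - nu * M3) - 2 * x * B * M6)) -
  p * s * ((nu * C) * M4 - 2 * x * nu * A * M3)); last by field.
by rewrite hB; field.
Qed.

Lemma hermite0_neq0 x : hermite 0 x != 0.
Proof.
rewrite /hermite oppr0 mul0r powRr0 mul1r kummerM0 [inv_gamma 0]inv_gammaS mul0r mulr0 mul0r.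
rewrite subr0 mulr1 mulf_neq0//; first by rewrite gt_eqF// sqrtr_gt0 pi_gt0.
by rewrite inv_gammaS mulf_neq0 ?inv_gamma_ge1 ?invr_eq0 ?gt_eqF ?euler_gamma_gt0//; lra.
Qed.

End hermite_rec.

(** * Integral representations *)

Section integrands.
Variable R : realType.
Implicit Types (c x xi s u X : R) (n : nat).

(* Here c = sqrt(2a), so a = c^2/2, and [charlier_fun] is what the substitution
   t = c u makes of t^(s-1) e^(-t) (1 + t/a)^n; when n = a - xi c, it tends to
   [weber_fun xi] as c grows. *)
Definition weber_fun x s u : R := u `^ (s - 1) * expR (- u ^+ 2 - 2 * x * u).

Definition charlier_fun c n s u : R :=
  u `^ (s - 1) * (expR (- (c * u)) * (1 + 2 * u / c) ^+ n).

Definition charlier_exponent c n u : R := - (c * u) + n%:R * ln (1 + 2 * u / c).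

Lemma charlier_funE c n s u : 0 < c -> 0 <= u ->
  charlier_fun c n s u = u `^ (s - 1) * expR (charlier_exponent c n u).
Proof.
move=> c0 u0; rewrite /charlier_exponent expRD expRM_natl lnK// posrE.
by rewrite ltr_pwDl// divr_ge0 ?mulr_ge0// ltW.
Qed.

Lemma weber_exponent_le X x u : `|x| <= X -> 0 <= u ->
  - u ^+ 2 - 2 * x * u <= (2 * X + 1) ^+ 2 - u.
Proof.
rewrite ler_norml => /andP[xX Xx] u0.
have X0 : 0 <= X by lra.
have : 0 <= (X + x) * u by rewrite mulr_ge0//; lra.
have : 0 <= (u / 2 - (2 * X + 1)) ^+ 2 by exact: sqr_ge0.
have : 0 <= u ^+ 2 by exact: sqr_ge0.
nra.
Qed.

(** The majorant is that of [weber_exponent_le], uniformly in c. Put B = 2X + 1. By [ln1D_le], c^2/2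
    ln(1 + 2u/c) - cu <= -u^2 c/(c + 2u), and this is at most B^2 - Bu once c >= 2B, the origin of
    that threshold. The part with xi adds at most 2Xu, leaving B^2 - u. *)
Lemma charlier_exponent_le X c n xi u : 0 <= X -> `|xi| <= X -> 2 * (2 * X + 1) <= c ->
  n%:R = c ^+ 2 / 2 - xi * c -> 0 <= u ->
  charlier_exponent c n u <= (2 * X + 1) ^+ 2 - u.
Proof.
move=> X0; rewrite ler_norml => /andP[xX Xx] Xc nE u0.
have c0 : 0 < c by lra.
set B := 2 * X + 1 in Xc *.
rewrite /charlier_exponent nE; set y := 2 * u / c.
have y0 : 0 <= y by rewrite divr_ge0 ?mulr_ge0// ltW.
have l1 := ln1D_le y0.
have l0 : 0 <= ln (1 + y) by rewrite ln_ge0// lerDl.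
have l2 : ln (1 + y) <= y.
  by apply: le_trans l1 _; rewrite gerBl divr_ge0 ?sqr_ge0// mulr_ge0// addr_ge0.
have h1 : c ^+ 2 / 2 * ln (1 + y) <= c * u - u ^+ 2 * c / (c + 2 * u).
  have -> : c * u - u ^+ 2 * c / (c + 2 * u) = c ^+ 2 / 2 * (y - y ^+ 2 / (2 * (1 + y))).
    rewrite /y; field.
    by rewrite (gt_eqF c0)/= gt_eqF// ltr_pwDl// mulr_ge0.
  by rewrite ler_wpM2l// divr_ge0// sqr_ge0.
have h2 : - (xi * c) * ln (1 + y) <= 2 * X * u.
  have -> : 2 * X * u = X * c * y by rewrite /y; field; rewrite gt_eqF.
  rewrite (@le_trans _ _ (X * c * ln (1 + y)))//.
    by rewrite ler_wpM2r// -mulNr ler_wpM2r ?(ltW c0)//; lra.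
  by rewrite ler_wpM2l// mulr_ge0// ltW.
have h3 : B * u - B ^+ 2 <= u ^+ 2 * c / (c + 2 * u).
  rewrite ler_pdivlMr; last by rewrite ltr_pwDl// mulr_ge0.
  have B0 : 0 <= B by rewrite /B; lra.
  have q0 : 0 <= u ^+ 2 - B * u + B ^+ 2.
    have := sqr_ge0 (u - B / 2); have := sqr_ge0 B; nra.
  have : 0 <= (c - 2 * B) * (u ^+ 2 - B * u + B ^+ 2) by rewrite mulr_ge0// subr_ge0.
  have : 0 <= B ^+ 2 * B by rewrite mulr_ge0// sqr_ge0.
  nra.
rewrite mulrDl /B in h1 h2 h3 *.
lra.
Qed.

(** Taylor expansion in y = 2u/c: the linear term of c^2/2 ln(1 + y) cancels cu, the quadratic one
    is exactly -u^2, and the cubic remainder is O(u^3/c). The part -xi c ln(1 + y) is -2 xi u up to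
    O(X u^2/c). *)
Lemma charlier_exponent_dist X c n xi x u : `|xi| <= X -> 0 < c ->
  n%:R = c ^+ 2 / 2 - xi * c -> 0 <= u ->
  `|charlier_exponent c n u - (- u ^+ 2 - 2 * x * u)| <=
  (2 * u ^+ 3 + 2 * X * u ^+ 2) / c + 2 * `|xi - x| * u.
Proof.
move=> xX c0 nE u0.
rewrite /charlier_exponent nE; set y := 2 * u / c.
have y0 : 0 <= y by rewrite divr_ge0 ?mulr_ge0// ltW.
have l1 := ln1D_ge y0; have l3 := ln1D_le3 y0; have l2 := ln1D_le y0.
set L := ln (1 + y) in l1 l2 l3 *.
have {}l2 : L <= y.
  by apply: le_trans l2 _; rewrite gerBl divr_ge0 ?sqr_ge0// mulr_ge0// addr_ge0.
have cu : c * u = c ^+ 2 / 2 * y by rewrite /y; field; rewrite gt_eqF.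
have uu : u ^+ 2 = c ^+ 2 / 2 * (y ^+ 2 / 2) by rewrite /y; field; rewrite gt_eqF.
have xu : 2 * x * u = x * c * y by rewrite /y; field; rewrite gt_eqF.
have -> : - (c * u) + (c ^+ 2 / 2 - xi * c) * L - (- u ^+ 2 - 2 * x * u) =
    c ^+ 2 / 2 * (L - (y - y ^+ 2 / 2)) + xi * c * (y - L) + 2 * (x - xi) * u.
  rewrite {1}cu uu xu.
  have -> : 2 * (x - xi) * u = (x - xi) * c * y by rewrite /y; field; rewrite gt_eqF.
  by field.
have c20 : 0 <= c ^+ 2 / 2 by rewrite divr_ge0 ?sqr_ge0.
have X0 : 0 <= X by rewrite (le_trans _ xX).
rewrite [X in _ <= X + _]mulrDl (le_trans (ler_normD _ _))// lerD//; last first.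
  by rewrite !normrM (ger0_norm u0) [`|x - xi|]distrC [`|2|]ger0_norm.
rewrite (le_trans (ler_normD _ _))// lerD//.
  rewrite ger0_norm; last by rewrite mulr_ge0// subr_ge0.
  apply: (@le_trans _ _ (c ^+ 2 / 2 * (y ^+ 3 / 3))).
    by rewrite ler_wpM2l// lerBlDl.
  have -> : c ^+ 2 / 2 * (y ^+ 3 / 3) = (4 / 3) * u ^+ 3 / c.
    by rewrite /y; field; rewrite gt_eqF.
  rewrite ler_pM2r ?invr_gt0// ler_wpM2r ?exprn_ge0//; lra.
rewrite !normrM (gtr0_norm c0) [`|y - L|]ger0_norm ?subr_ge0//.
have -> : 2 * X * u ^+ 2 / c = X * c * (y ^+ 2 / 2) by rewrite /y; field; rewrite gt_eqF.
by rewrite ler_pM ?mulr_ge0 ?subr_ge0 ?(ltW c0)// ?ler_wpM2r ?(ltW c0)//; lra.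
Qed.

Lemma powR_mulX u p k : 0 < u -> u `^ p * u ^+ k = u `^ (p + k%:R).
Proof.
by move=> u0; rewrite powRD ?(gt_eqF u0) ?implybT// powR_mulrn// ltW.
Qed.

(** The first factor comes from the bound on the exponents, the second from [powR_le_expR] at rate
    1/2. [P + 2] is the largest power met: u^(s-1) with s <= P, times the u^3 of the Taylor
    remainder. *)
Definition integrand_const X (P : R) : R := expR ((2 * X + 1) ^+ 2) *
  (1 + (Num.truncn (P + 2)).+1`!%:R / 2^-1 ^+ (Num.truncn (P + 2)).+1).

Lemma powR_integrand_le X P p u e : 0 <= p <= P + 2 -> 0 <= u ->
  e <= (2 * X + 1) ^+ 2 - u ->
  u `^ p * expR e <= integrand_const X P * expR (- u / 2).
Proof.
move=> pP u0 eX; have c0 : 0 < 2^-1 :> R by rewrite invr_gt0.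
rewrite /integrand_const mulrC -mulrA; apply: le_trans (_ : expR ((2 * X + 1) ^+ 2 - u) * u `^ p <= _).
  by rewrite ler_wpM2r ?powR_ge0// ler_expR.
rewrite expRD -mulrA ler_wpM2l ?expR_ge0// mulrC.
rewrite (_ : - u / 2 = 2^-1 * u - u); last by field.
by rewrite expRD mulrA ler_wpM2r ?expR_ge0// powR_le_expR.
Qed.

Lemma charlier_weber_fun_dist X P c n xi x s s' u : 0 <= X -> `|xi| <= X -> `|x| <= X ->
  2 * (2 * X + 1) <= c -> n%:R = c ^+ 2 / 2 - xi * c ->
  2 <= s <= P -> 2 <= s' <= P -> 0 <= u ->
  `|charlier_fun c n s u - weber_fun x s' u| <=
  (4 + 2 * X) * integrand_const X P * (c^-1 + `|s - s'| + `|xi - x|) * expR (- u / 2).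
Proof.
move=> X0 xiX xX Xc nE /andP[s2 sP] /andP[s'2 s'P].
have c0 : 0 < c by lra.
have ic0 : 0 <= c^-1 by rewrite invr_ge0 ltW.
set K := integrand_const X P.
have K0 : 0 <= K.
  by rewrite mulr_ge0 ?expR_ge0// addr_ge0// divr_ge0// exprn_ge0// invr_ge0.
rewrite le_eqVlt => /predU1P[<-|u0].
  rewrite /charlier_fun /weber_fun !powR0; [|lra|lra].
  by rewrite !mul0r subrr normr0 !mulr_ge0 ?expR_ge0 ?addr_ge0// mulr_ge0.
rewrite charlier_funE ?(ltW u0)// /weber_fun; set e := charlier_exponent c n u; set e' := - u ^+ 2 - _.
set E := (2 * X + 1) ^+ 2 - u.
have eE : e <= E by exact: (charlier_exponent_le X0 xiX Xc nE (ltW u0)).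
have e'E : e' <= E by apply: weber_exponent_le => //; exact: ltW.
have dE := charlier_exponent_dist x xiX c0 nE (ltW u0); rewrite -/e -/e' in dE.
(* Change the exponential first, then the power. The second change costs 1/u, so u^(s-2) and
   u^(s'-2) appear; the lower bound 2 on s and s' keeps these exponents nonnegative. *)
have -> : u `^ (s - 1) * expR e - u `^ (s' - 1) * expR e' =
   u `^ (s - 1) * (expR e - expR e') + (u `^ (s - 1) - u `^ (s' - 1)) * expR e'.
  by ring.
have pw p : 0 <= p <= P + 2 -> u `^ p * expR E <= K * expR (- u / 2).
  by move=> pP; apply: powR_integrand_le => //; exact: ltW.
set Q := K * expR (- u / 2).
have Q0 : 0 <= Q by rewrite mulr_ge0// expR_ge0.
have t1 : `|u `^ (s - 1) * (expR e - expR e')| <= (2 + 2 * X) * c^-1 * Q + 2 * `|xi - x| * Q.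
  rewrite normrM (ger0_norm (powR_ge0 _ _)).
  apply: (@le_trans _ _ (u `^ (s - 1) * (((2 * u ^+ 3 + 2 * X * u ^+ 2) / c + 2 * `|xi - x| * u) * expR E))).
    rewrite ler_wpM2l ?powR_ge0// (le_trans (expR_dist_le eE e'E))//.
    by rewrite ler_wpM2r ?expR_ge0.
  have -> : u `^ (s - 1) * (((2 * u ^+ 3 + 2 * X * u ^+ 2) / c + 2 * `|xi - x| * u) * expR E) =
     2 * c^-1 * ((u `^ (s - 1) * u ^+ 3) * expR E) + 2 * X * c^-1 * ((u `^ (s - 1) * u ^+ 2) * expR E)
     + 2 * `|xi - x| * ((u `^ (s - 1) * u ^+ 1) * expR E) by ring.
  rewrite !powR_mulX//.
  have -> : (2 + 2 * X) * c^-1 * Q = 2 * c^-1 * Q + 2 * X * c^-1 * Q by ring.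
  rewrite lerD//; last first.
    by rewrite ler_wpM2l ?mulr_ge0// pw//; clear -s2 sP s'2 s'P; apply/andP; split; lra.
  by rewrite lerD// ler_wpM2l ?mulr_ge0// pw//; clear -s2 sP s'2 s'P; apply/andP; split; lra.
have t2 : `|(u `^ (s - 1) - u `^ (s' - 1)) * expR e'| <= 4 * `|s - s'| * Q.
  rewrite normrM (ger0_norm (expR_ge0 _)).
  apply: (@le_trans _ _ (`|s - s'| * ((u + u^-1) * (u `^ (s - 1) + u `^ (s' - 1))) * expR E)).
    apply: ler_pM; rewrite ?expR_ge0 ?ler_expR//.
    have -> : s - s' = s - 1 - (s' - 1) by ring.
    exact: powR_dist_le.
  have um p : u^-1 * u `^ p = u `^ (p - 1).
    by rewrite powRB ?(gt_eqF u0) ?implybT// powRr1 1?mulrC// ltW.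
  have -> : `|s - s'| * ((u + u^-1) * (u `^ (s - 1) + u `^ (s' - 1))) * expR E =
    `|s - s'| * ((u `^ (s - 1) * u ^+ 1) * expR E + (u `^ (s' - 1) * u ^+ 1) * expR E +
    (u^-1 * u `^ (s - 1)) * expR E + (u^-1 * u `^ (s' - 1)) * expR E) by ring.
  rewrite !powR_mulX// !um [4 * _]mulrC -mulrA ler_wpM2l//.
  have -> : 4 * Q = Q + Q + Q + Q by ring.
  by rewrite !lerD// pw//; clear -s2 sP s'2 s'P; apply/andP; split; lra.
rewrite (le_trans (ler_normD _ _))// (le_trans (lerD t1 t2))//.
have -> : (4 + 2 * X) * K * (c^-1 + `|s - s'| + `|xi - x|) * expR (- u / 2) =
  (4 + 2 * X) * c^-1 * Q + (4 + 2 * X) * `|s - s'| * Q + (4 + 2 * X) * `|xi - x| * Q.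
  by rewrite /Q; ring.
have XX : 0 <= 2 * X by rewrite mulr_ge0.
rewrite addrAC lerD//; last by rewrite ler_wpM2r// ler_wpM2r//; lra.
by rewrite lerD// ler_wpM2r// ler_wpM2r//; clear -XX; lra.
Qed.

Lemma weber_fun_dom x s : 1 <= s -> exp_dominated (weber_fun x s).
Proof.
move=> s1; apply: (@continuous_exp_dom _ _ (integrand_const `|x| s)).
  apply: within_continuousM; first by apply: within_continuous_powR; rewrite subr_ge0.
  apply: within_continuous_expR => t; apply: cvgB.
    by apply: cvgN; exact: exprn_continuous.
  by apply: cvgMr; exact: cvg_id.
move=> t t0; rewrite ger0_norm ?mulr_ge0 ?powR_ge0 ?expR_ge0//.
apply: powR_integrand_le => //; last exact: weber_exponent_le.
by apply/andP; split; lra.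
Qed.

Lemma charlier_fun_continuous c n s : 1 <= s ->
  {within `[0, +oo[, continuous (charlier_fun c n s)}.
Proof.
move=> s1.
apply: within_continuousM; first by apply: within_continuous_powR; rewrite subr_ge0.
apply: within_continuousM.
  apply: within_continuous_expR => t; apply: cvgN; apply: cvgMr; exact: cvg_id.
have h : continuous (fun t : R => 1 + 2 * t / c).
  move=> t; apply: cvgD; first exact: cvg_cst.
  by apply: cvgMl; apply: cvgMr; exact: cvg_id.
apply: continuous_subspaceT => t.
exact: (continuous_comp (h t) (@exprn_continuous R n _)).
Qed.

Lemma charlier_fun_dom X c n xi s : 0 <= X -> `|xi| <= X -> 2 * (2 * X + 1) <= c ->
  n%:R = c ^+ 2 / 2 - xi * c -> 1 <= s -> exp_dominated (charlier_fun c n s).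
Proof.
move=> X0 xX Xc nE s1.
apply: (@continuous_exp_dom _ _ (integrand_const X s)); first exact: charlier_fun_continuous.
move=> t t0; have c0 : 0 < c by lra.
rewrite charlier_funE// ger0_norm ?mulr_ge0 ?powR_ge0 ?expR_ge0//.
apply: powR_integrand_le => //; last exact: (charlier_exponent_le X0 xX Xc nE t0).
by apply/andP; split; lra.
Qed.

Lemma Int_charlier_weber_dist X P c n xi x s s' : 0 <= X -> `|xi| <= X -> `|x| <= X ->
  2 * (2 * X + 1) <= c -> n%:R = c ^+ 2 / 2 - xi * c ->
  2 <= s <= P -> 2 <= s' <= P ->
  `|Int (charlier_fun c n s) - Int (weber_fun x s')| <=
  (4 + 2 * X) * integrand_const X P * (c^-1 + `|s - s'| + `|xi - x|) * 2.
Proof.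
move=> X0 xiX xX Xc nE sP s'P.
have dC : exp_dominated (charlier_fun c n s).
  by apply: charlier_fun_dom X0 xiX Xc nE _; lra.
have dW : exp_dominated (weber_fun x s') by apply: weber_fun_dom; lra.
rewrite -IntB//; apply: Int_norm_le; first exact: exp_domB.
by move=> u u0; exact: charlier_weber_fun_dist.
Qed.

Lemma Int_weber_gt0 x s : 1 <= s -> 0 < Int (weber_fun x s).
Proof.
move=> s1; apply: (@Int_gt0 _ _ (expR (- 4 - 4 * `|x|))).
- exact: weber_fun_dom.
- by move=> t _; rewrite mulr_ge0 ?powR_ge0 ?expR_ge0.
- exact: expR_gt0.
- move=> t /andP[t1 t2]; rewrite -[leLHS]mul1r ler_pM ?expR_ge0//.
    by rewrite -[leLHS](powRr0 t) ler_powR// subr_ge0.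
  rewrite ler_expR.
  have := ler_norm x; have := normr_ge0 x; nra.
Qed.

End integrands.

Section representations.
Variable R : realType.
Implicit Types (c x s u z : R) (n k : nat).

Lemma charlier_Int c n s : 0 < c -> 1 <= s -> exp_dominated (charlier_fun c n s) ->
  euler_gamma s * charlier (c ^+ 2 / 2) n (- s) = c `^ s * Int (charlier_fun c n s).
Proof.
move=> c0 s1 dC; set a := c ^+ 2 / 2.
have a0 : a != 0 by rewrite gt_eqF// divr_gt0// exprn_gt0.
pose f t : R := gamma_fun (s - 1) t * (1 + t / a) ^+ n.
have cn0 : c != 0 by rewrite gt_eqF.
have cf : {within `[0, +oo[, continuous f}.
  apply: within_continuousM; first by apply: within_continuous_gamma_fun; rewrite subr_ge0.
  have h : continuous (fun t : R => 1 + t / a).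
    by move=> t; apply: cvgD; [exact: cvg_cst|apply: cvgMl; exact: cvg_id].
  apply: continuous_subspaceT => t.
  exact: (continuous_comp (h t) (@exprn_continuous R n _)).
have fc t : 0 <= t -> f (c * t) = c `^ (s - 1) * charlier_fun c n s t.
  move=> t0; rewrite /f /gamma_fun /charlier_fun powRM// ?(ltW c0)//.
  have -> : c * t / a = 2 * t / c by rewrite /a; field.
  by ring.
have f0 t : 0 <= t -> 0 <= f t.
  move=> t0; rewrite mulr_ge0 ?gamma_fun_ge0// exprn_ge0// addr_ge0// divr_ge0//.
  by rewrite divr_ge0// sqr_ge0.
have cfc : {within `[0, +oo[, continuous (fun t => f (c * t))}.
  have h : {within `[0, +oo[, continuous (fun t => c `^ (s - 1) * charlier_fun c n s t)}.
    apply: within_continuousM; last exact: charlier_fun_continuous.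
    by move=> t; exact: cvg_cst.
  apply: (subspace_eq_continuous _ h) => t; rewrite inE/= in_itv/= andbT => t0.
  exact/esym/fc.
have -> : c `^ s * Int (charlier_fun c n s) = Int f.
  rewrite (Int_scale c0 cf f0 cfc) -(mulr_powRB1 (ltW c0)) ?(lt_le_trans _ s1)//.
  rewrite -IntZ//; apply: eq_Int => t t0; rewrite (fc _ (ltW t0)); ring.
rewrite charlier_neg mulr_sumr.
pose F k t : R := 'C(n, k)%:R * a ^- k * gamma_fun (s + k%:R - 1) t.
have gk k : 0 <= s + k%:R - 1 by have := ler0n R k; lra.
have dF k : exp_dominated (F k) by apply: exp_domZ; exact: gamma_fun_dom.
transitivity (Int (fun t => \sum_(k < n.+1) F k t)); last first.
  apply: eq_Int => t t0; rewrite /f exprDn mulr_sumr; apply: eq_bigr => k _.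
  rewrite /F /gamma_fun expr1n mul1r -[X in _ = _ * X]mulr_natl.
  have -> : s + k%:R - 1 = s - 1 + k%:R by ring.
  rewrite -powR_mulX// [(t / a) ^+ k]expr_div_n; move: (a ^- k) (t ^+ k) => q r; ring.
rewrite Int_sum//; apply: eq_bigr => k _.
rewrite /F IntZ; last exact: gamma_fun_dom.
by rewrite -euler_gammaE euler_gammaD//; ring.
Qed.

Lemma Int_weber0 z : 1 <= z -> Int (weber_fun 0 (2 * z)) = euler_gamma z / 2.
Proof.
move=> z1; have z10 : 0 <= z - 1 by rewrite subr_ge0.
have e t : 0 <= t -> gamma_fun (z - 1) (t ^+ 2) = t `^ (2 * (z - 1)) * expR (- t ^+ 2).
  by move=> t0; rewrite /gamma_fun powRrM powR_mulrn.
rewrite euler_gammaE (@Int_sqr _ (gamma_fun (z - 1))).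
- rewrite -[LHS](mulfK (_ : 2 != 0 :> R))//; congr (_ / _).
  rewrite [LHS]mulrC -[LHS]IntZ; last by apply: weber_fun_dom; lra.
  apply: eq_Int => t t0; rewrite e ?(ltW t0)// /weber_fun mulr0 mul0r subr0.
  have -> : 2 * z - 1 = 2 * (z - 1) + 1%:R by ring.
  by rewrite -powR_mulX// expr1; ring.
- exact: within_continuous_gamma_fun.
- by move=> t _; exact: gamma_fun_ge0.
- have h : {within `[0, +oo[, continuous (fun t : R => t `^ (2 * (z - 1)) * expR (- t ^+ 2))}.
    apply: within_continuousM; first by apply: within_continuous_powR; rewrite mulr_ge0.
    by apply: within_continuous_expR => t; apply: cvgN; exact: exprn_continuous.
  apply: (subspace_eq_continuous _ h) => t; rewrite inE/= in_itv/= andbT => t0.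
  exact/esym/e.
Qed.

Lemma series_exp_le (y : R) n : `|series (exp_coeff y) n| <= expR `|y|.
Proof.
apply: (@le_trans _ _ (series (exp_coeff `|y|) n)).
  rewrite /series /= (le_trans (ler_norm_sum _ _ _))// ler_sum// => k _.
  by rewrite /exp_coeff /= normrM normrX normfV normr_nat.
apply: nondecreasing_cvgn_le; last exact: is_cvg_series_exp_coeff.
by apply/nondecreasing_seqP => k; rewrite /series /= big_nat_recr//= lerDl exp_coeff_ge0.
Qed.

Lemma cvg_Int_weber x s : 1 <= s ->
  (\sum_(k < n) (- 2 * x) ^+ k / k`!%:R * Int (weber_fun 0 (s + k%:R))) @[n --> \oo] -->
  Int (weber_fun x s).
Proof.
move=> s1.
have sk k : 1 <= s + k%:R by have := ler0n R k; lra.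
pose F k u : R := (- 2 * x) ^+ k / k`!%:R * weber_fun 0 (s + k%:R) u.
have dF k : exp_dominated (F k) by apply: exp_domZ; exact: weber_fun_dom.
pose f n u : R := \sum_(k < n) F k u.
have df n : exp_dominated (f n) by exact: exp_dom_sum.
have fE n u : 0 < u -> f n u = weber_fun 0 s u * series (exp_coeff (- 2 * x * u)) n.
  move=> u0; rewrite /f /series /= big_mkord mulr_sumr; apply: eq_bigr => k _.
  rewrite /F /weber_fun /exp_coeff /=.
  have -> : s + k%:R - 1 = s - 1 + k%:R by ring.
  by rewrite -powR_mulX// [(-2 * x * u) ^+ k]exprMn; move: ((- 2 * x) ^+ k) (u ^+ k) => p q; ring.
rewrite (_ : (fun n => _) = (fun n => Int (f n))); last first.
  apply/funext => n; rewrite /f Int_sum//; apply: eq_bigr => k _.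
  by rewrite /F IntZ//; exact: weber_fun_dom.
have dW : exp_dominated (weber_fun x s) by exact: weber_fun_dom.
have dG : exp_dominated (weber_fun (- `|x|) s) by exact: weber_fun_dom.
have mD : measurable (`](0 : R), +oo[%classic) by [].
have i1 n : measurable_fun `](0 : R), +oo[ (EFin \o f n).
  by apply/measurable_EFinP; have [] := df n.
have i2 : measurable_fun `](0 : R), +oo[ (EFin \o weber_fun x s).
  by apply/measurable_EFinP; have [] := dW.
have i3 : {ae @lebesgue_measure R, forall u, (`](0 : R), +oo[%classic : set R) u ->
    (EFin \o f n) u @[n --> \oo] --> (EFin \o weber_fun x s) u}.
  apply: aeW => u /=; rewrite in_itv/= andbT => u0.
  apply: cvg_EFin; first exact: nearW.
  rewrite (_ : _ \o _ = (fun n => weber_fun 0 s u * series (exp_coeff (- 2 * x * u)) n)); last first.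
    by apply/funext => n /=; rewrite fE.
  have -> : weber_fun x s u = weber_fun 0 s u * expR (- 2 * x * u).
    by rewrite /weber_fun -[RHS]mulrA -expRD; congr (_ * expR _); ring.
  by apply: cvgMr; exact: is_cvg_series_exp_coeff.
have i4 : (@lebesgue_measure R).-integrable `](0 : R), +oo[ (EFin \o weber_fun (- `|x|) s).
  exact: exp_dom_integrable.
have i5 : {ae @lebesgue_measure R, forall u n, (`](0 : R), +oo[%classic : set R) u ->
    (`|(EFin \o f n) u| <= (EFin \o weber_fun (- `|x|) s) u)%E}.
  apply: aeW => u n /=; rewrite in_itv/= andbT => u0.
  rewrite lee_fin fE// normrM.
  have -> : weber_fun (- `|x|) s u = weber_fun 0 s u * expR `|- 2 * x * u|.
    rewrite /weber_fun -[RHS]mulrA -expRD !normrM normrN (gtr0_norm u0).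
    by rewrite [`|2|]ger0_norm//; congr (_ * expR _); ring.
  rewrite ger0_norm; last by rewrite mulr_ge0 ?powR_ge0 ?expR_ge0.
  by rewrite ler_wpM2l ?series_exp_le// mulr_ge0 ?powR_ge0 ?expR_ge0.
have [_ _ h] := @dominated_convergence _ _ R lebesgue_measure _ mD
  (fun n => EFin \o f n) (EFin \o weber_fun x s) (EFin \o weber_fun (- `|x|) s) i1 i2 i3 i4 i5.
rewrite /Int /Rintegral.
have fW : (\int[@lebesgue_measure R]_(u in `](0 : R)%R, +oo[) (weber_fun x s u)%:E)%E \is a fin_num.
  by apply: integrable_fin_num => //; exact: exp_dom_integrable.
apply: fine_cvg; rewrite fineK//.
Qed.

(* Legendre's duplication formula would give hermite_const s = 1 / Gamma(s); only
   [hermite_constS] is needed. *)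
Definition hermite_const s : R :=
  2 `^ (1 - s) * Num.sqrt pi / (euler_gamma (s / 2) * euler_gamma ((s + 1) / 2)).

Lemma hermite_constS s : 2 <= s -> hermite_const s = s * hermite_const (s + 1).
Proof.
move=> s2; rewrite /hermite_const.
have -> : (s + 1 + 1) / 2 = s / 2 + 1 by field.
rewrite (@euler_gammaS _ (s / 2)); last by lra.
have -> : 2 `^ (1 - s) = 2 * 2 `^ (1 - (s + 1)) :> R.
  have -> : 1 - s = 1 - (s + 1) + 1%:R by ring.
  by rewrite -powR_mulX// expr1 mulrC.
have s0 : s != 0 by rewrite gt_eqF//; lra.
have h1 : 1 <= s / 2 by lra.
have h2 : 1 <= (s + 1) / 2 by lra.
have := lt0r_neq0 (euler_gamma_gt0 h1); have := lt0r_neq0 (euler_gamma_gt0 h2).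
move: (euler_gamma _) (euler_gamma _) => u v u0 v0.
by field; rewrite u0 v0 s0.
Qed.

Lemma hermite_const_gt0 s : 2 <= s -> 0 < hermite_const s.
Proof.
move=> s2; rewrite /hermite_const divr_gt0//.
  by rewrite mulr_gt0 ?powR_gt0// sqrtr_gt0 pi_gt0.
by rewrite mulr_gt0// euler_gamma_gt0//; lra.
Qed.

Lemma fact_even k : (2 * k)`!%:R = 4 ^+ k * k`!%:R * rising_fact (1 / 2) k :> R.
Proof.
elim: k => [|k IH]; first by rewrite /rising_fact big_ord0 !fact0 expr0 !mulr1.
rewrite mulnS !factS !natrM IH rising_factS exprS -[(2 * k).+2%:R]natr1 -[(2 * k).+1%:R]natr1.
by rewrite natrM -natr1; field.
Qed.

Lemma fact_odd k : (2 * k).+1`!%:R = 4 ^+ k * k`!%:R * rising_fact (3 / 2) k :> R.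
Proof.
elim: k => [|k IH]; first by rewrite /rising_fact big_ord0 !fact0 expr0 !mulr1.
have -> : (2 * k.+1).+1 = (2 * k).+3 by rewrite mulnS.
rewrite (factS (2 * k).+2) (factS (2 * k).+1) 2!natrM IH rising_factS exprS.
rewrite factS natrM -[(2 * k).+3%:R]natr1 -[(2 * k).+2%:R]natr1 -[(2 * k).+1%:R]natr1.
by rewrite natrM -natr1; field.
Qed.

(** Split the series in x by parity: (2k)! = 4^k k! (1/2)_k and (2k+1)! = 4^k k! (3/2)_k turn the
    two halves into Kummer series. The identity already holds between the sum of 2n terms and the
    partial sums of length n. *)
Lemma Int_weber_kummer x s : 2 <= s -> Int (weber_fun x s) =
  euler_gamma (s / 2) / 2 * kummerM (s / 2) (1 / 2) (x ^+ 2) -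
  x * euler_gamma ((s + 1) / 2) * kummerM ((s + 1) / 2) (3 / 2) (x ^+ 2).
Proof.
move=> s2; have s1 : 1 <= s by lra.
have h1 := @cvg_Int_weber x s s1.
have h2 : (\sum_(k < n.*2) (- 2 * x) ^+ k / k`!%:R * Int (weber_fun 0 (s + k%:R)))
    @[n --> \oo] --> Int (weber_fun x s).
  apply: (cvg_comp _ _ _ h1); apply/cvgnyPge => N; near=> n.
  by rewrite -addnn (leq_trans _ (leq_addr _ _))//; near: n; exact: nbhs_infty_ge.
apply: cvg_unique h2 _ => //.
have h3 : (euler_gamma (s / 2) / 2 * pseries (kummer_coef (s / 2) (1 / 2)) (x ^+ 2) n -
  x * euler_gamma ((s + 1) / 2) * pseries (kummer_coef ((s + 1) / 2) (3 / 2)) (x ^+ 2) n)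
  @[n --> \oo] --> euler_gamma (s / 2) / 2 * kummerM (s / 2) (1 / 2) (x ^+ 2) -
  x * euler_gamma ((s + 1) / 2) * kummerM ((s + 1) / 2) (3 / 2) (x ^+ 2).
  by apply: cvgB; apply: cvgMr; apply: kummerMP; lra.
rewrite (_ : (fun n => _) = (fun n =>
  euler_gamma (s / 2) / 2 * pseries (kummer_coef (s / 2) (1 / 2)) (x ^+ 2) n -
  x * euler_gamma ((s + 1) / 2) * pseries (kummer_coef ((s + 1) / 2) (3 / 2)) (x ^+ 2) n))//.
apply/funext => n; rewrite /pseries /series /=.
elim: n => [|n IH]; first by rewrite double0 big_ord0 !big_nil !mulr0 subr0.
rewrite doubleS !big_ord_recr/= IH !big_nat_recr//=.
have fk : n`!%:R != 0 :> R by rewrite pnatr_eq0 -lt0n fact_gt0.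
have r1 : rising_fact (1 / 2) n != 0 :> R by rewrite gt_eqF// rising_fact_gt0//; lra.
have r2 : rising_fact (3 / 2) n != 0 :> R by rewrite gt_eqF// rising_fact_gt0//; lra.
have -> : s + n.*2%:R = 2 * (s / 2 + n%:R) by rewrite -muln2 natrM; field.
have -> : s + n.*2.+1%:R = 2 * ((s + 1) / 2 + n%:R).
  by rewrite -natr1 -muln2 natrM; field.
have sl1 : 1 <= s / 2 by clear -s2; lra.
have sl2 : 1 <= (s + 1) / 2 by clear -s2; lra.
have sn1 : 1 <= s / 2 + n%:R by rewrite (le_trans sl1)// lerDl.
have sn2 : 1 <= (s + 1) / 2 + n%:R by rewrite (le_trans sl2)// lerDl.
rewrite (Int_weber0 sn1) (Int_weber0 sn2).
rewrite (euler_gammaD _ sl1) (euler_gammaD _ sl2).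
rewrite -mul2n fact_even fact_odd [(-2 * x) ^+ (2 * n).+1]exprS [(-2 * x) ^+ (2 * n)]exprM.
have -> : (- 2 * x) ^+ 2 = 4 * x ^+ 2 :> R by ring.
rewrite exprMn /kummer_coef.
have f4 : 4 ^+ n != 0 :> R by rewrite expf_neq0.
move: (4 ^+ n) f4 ((x ^+ 2) ^+ n) => q q0 y.
move: (\sum_(_ <= _ < _) _) => S1; move: (\sum_(_ <= _ < _) _) => S2.
move: (euler_gamma _) (euler_gamma _) => G1 G2.
move: (rising_fact (s / 2) n) (rising_fact ((s + 1) / 2) n) => p1 p2.
move: (rising_fact _ n) (rising_fact _ n) r1 r2 => q1 q2 r1 r2.
move: (n`!%:R : R) fk => f fk.
by field; rewrite fk r1 r2 q0.
Unshelve. all: by end_near. Qed.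

Lemma hermite_Int x s : 2 <= s ->
  hermite (- s) x = hermite_const s * Int (weber_fun x s).
Proof.
move=> s2; rewrite Int_weber_kummer// /hermite /hermite_const opprK.
have h1 : 1 <= s / 2 by lra.
have h2 : 1 <= (s + 1) / 2 by lra.
have -> : (1 + s) / 2 = (s + 1) / 2 by rewrite addrC.
rewrite (inv_gamma_ge1 h1) (inv_gamma_ge1 h2).
have -> : 2 `^ (1 - s) = 2 * 2 `^ (- s) :> R.
  have -> : 1 - s = - s + 1%:R by ring.
  by rewrite -powR_mulX// expr1 mulrC.
have := lt0r_neq0 (euler_gamma_gt0 h1); have := lt0r_neq0 (euler_gamma_gt0 h2).
move: (euler_gamma _) (euler_gamma _) => u v u0 v0.
move: (kummerM _ _ _) (kummerM _ _ _) (2 `^ (- s)) (Num.sqrt pi) => M1 M2 p q.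
by field; rewrite u0 v0.
Qed.

End representations.

(** * Charlier polynomials tend to the Hermite function *)

Section asymptotics.
Variable R : realType.
Implicit Types (c x xi s z nu X : R) (n k : nat).

(* (2a)^(z/2) c_n^a(z) with c = sqrt(2a) *)
Definition scaled_charlier c n z : R := c `^ z * charlier (c ^+ 2 / 2) n z.

(** This is [hermiteS] with xi for x and the single perturbation 2z/c. *)
Lemma scaled_charlierS c n xi z : 0 < c -> n%:R = c ^+ 2 / 2 - xi * c ->
  scaled_charlier c n (z + 1) =
  (2 * xi + 2 * z / c) * scaled_charlier c n z - 2 * z * scaled_charlier c n (z - 1).
Proof.
move=> c0 nE; set a := c ^+ 2 / 2.
have cn0 : c != 0 by rewrite gt_eqF.
have a0 : a != 0 by rewrite gt_eqF// divr_gt0// exprn_gt0.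
have h := charlier_rec_z n z a0.
rewrite /scaled_charlier -/a.
have -> : charlier a n (z + 1) = ((z + xi * c) * charlier a n z - z * charlier a n (z - 1)) / a.
  apply: (mulfI a0); rewrite mulrC [RHS]mulrC divfK// mulrC h nE.
  by congr (_ * _ - _); rewrite /a; ring.
have p1 : c `^ (z + 1) = c * c `^ z by rewrite -[X in z + X]/1%:R -powR_mulX// mulrC.
have p2 : c `^ z = c * c `^ (z - 1).
  by rewrite -{1}[z](subrK 1) -[X in z - 1 + X]/1%:R -powR_mulX// mulrC.
have ca : c ^+ 2 = 2 * a by rewrite /a; field.
rewrite p1 p2 /a; by field.
Qed.

Lemma scaled_charlier_neg c n s : 0 < c -> 1 <= s -> exp_dominated (charlier_fun c n s) ->
  euler_gamma s * scaled_charlier c n (- s) = Int (charlier_fun c n s).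
Proof.
move=> c0 s1 dC; rewrite /scaled_charlier mulrCA charlier_Int// mulrA powRN mulVf ?mul1r//.
by rewrite gt_eqF// powR_gt0.
Qed.

(* n = a - xi sqrt(2a) with bounded xi and c = sqrt(2a) large. *)
Definition near_regime X c n xi :=
  [/\ `|xi| <= X, 2 * (2 * X + 1) <= c & n%:R = c ^+ 2 / 2 - xi * c].

Lemma scaled_charlier_cvg0 X x s' : 0 <= X -> `|x| <= X -> 2 <= s' <= 6 ->
  exists2 K, 0 <= K & forall c n xi s, near_regime X c n xi -> 2 <= s <= 6 ->
  `|euler_gamma s * scaled_charlier c n (- s) - Int (weber_fun x s')| <=
    K * (c^-1 + `|s - s'| + `|xi - x|).
Proof.
move=> X0 xX s'P.
exists ((4 + 2 * X) * integrand_const X 6 * 2).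
  rewrite mulr_ge0// mulr_ge0//; first by lra.
  by rewrite mulr_ge0 ?expR_ge0// addr_ge0// divr_ge0// exprn_ge0// invr_ge0.
move=> c n xi s [xiX Xc nE] sP; have c0 : 0 < c by lra.
have dC : exp_dominated (charlier_fun c n s).
  by apply: (charlier_fun_dom X0 xiX Xc nE); lra.
rewrite scaled_charlier_neg//; last by lra.
by rewrite mulrAC; exact: Int_charlier_weber_dist.
Qed.

Lemma scaled_charlier_cvg_step X x s' k K0 K1 G0 G1 :
  0 <= X -> `|x| <= X -> 4 <= s' <= 5 -> 0 <= K0 -> 0 <= K1 ->
  exists2 K, 0 <= K & forall c n xi s, near_regime X c n xi -> 3 <= s <= 6 ->
  let e := c^-1 + `|s - s'| + `|xi - x| in
  `|euler_gamma s * scaled_charlier c n (k%:R - s) - G0| <= K0 * e ->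
  `|euler_gamma s * scaled_charlier c n (k.+1%:R - s) - G1| <= K1 * e ->
  `|euler_gamma s * scaled_charlier c n (k.+2%:R - s) -
    (2 * x * G1 - 2 * (k.+1%:R - s') * G0)| <= K * e.
Proof.
move=> X0 xX /andP[s4 s5] K00 K10.
(* Z bounds |z| for z = k + 1 - s. E bounds the whole error e, which makes |F1| bounded; the
   perturbing term (2z/c) F1 is then a constant times 1/c, hence a constant times e. *)
pose Z := k%:R + 7 : R; have Z0 : 0 <= Z by rewrite addr_ge0.
pose E := 4 + 2 * X; have E0 : 0 <= E by rewrite /E; lra.
exists (2 * X * K1 + 2 * `|G1| + 2 * Z * (`|G1| + K1 * E) + 2 * Z * K0 + 2 * `|G0|).
  by rewrite !addr_ge0// ?mulr_ge0// ?mulr_ge0// addr_ge0// mulr_ge0.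
move=> c n xi s [xiX Xc nE] /andP[s3 s6] e h0 h1.
have c0 : 0 < c by lra.
have := scaled_charlierS (k.+1%:R - s) c0 nE.
have -> : k.+1%:R - s + 1 = k.+2%:R - s by rewrite -[k.+2%:R]natr1; ring.
have -> : k.+1%:R - s - 1 = k%:R - s by rewrite -[k.+1%:R]natr1; ring.
move=> ->; set z := k.+1%:R - s; set F0 := euler_gamma s * scaled_charlier c n (k%:R - s) in h0 *.
set F1 := euler_gamma s * scaled_charlier c n z in h1 *.
have -> : euler_gamma s * ((2 * xi + 2 * z / c) * scaled_charlier c n z -
    2 * z * scaled_charlier c n (k%:R - s)) - (2 * x * G1 - 2 * (k.+1%:R - s') * G0) =
  2 * xi * (F1 - G1) + 2 * (xi - x) * G1 + 2 * z * c^-1 * F1 - 2 * z * (F0 - G0) - 2 * (s' - s) * G0.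
  by rewrite /F1 /F0 /z; ring.
have ci0 : 0 <= c^-1 by rewrite invr_ge0 ltW.
have ci1 : c^-1 <= 1 by rewrite invf_le1//; lra.
have n1 : 0 <= `|s - s'| by []. have n2 : 0 <= `|xi - x| by [].
have e0 : 0 <= e by rewrite /e !addr_ge0.
have eE : e <= E.
  rewrite /e /E.
  have : `|s - s'| <= 2 by rewrite ler_norml; lra.
  have : `|xi - x| <= 2 * X by rewrite (le_trans (ler_normB _ _))//; lra.
  lra.
have zZ : `|z| <= Z.
  rewrite /z /Z -natr1 ler_norml; have := ler0n R k; lra.
have F1b : `|F1| <= `|G1| + K1 * E.
  have -> : F1 = G1 + (F1 - G1) by ring.
  rewrite (le_trans (ler_normD _ _))// lerD// (le_trans h1)// ler_wpM2l//.
have e1 : `|xi - x| <= e by rewrite /e; lra.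
have e2 : `|s - s'| <= e by rewrite /e; lra.
have e3 : c^-1 <= e by rewrite /e; lra.
clearbody F0 F1 z.
have b1 : `|2 * xi * (F1 - G1)| <= 2 * X * K1 * e.
  rewrite !normrM [`|2|]ger0_norm// -[leRHS]mulrA.
  by apply: ler_pM; rewrite ?mulr_ge0// ler_wpM2l.
have b2 : `|2 * (xi - x) * G1| <= 2 * `|G1| * e.
  by rewrite !normrM [`|2|]ger0_norm// mulrAC ler_wpM2l// mulr_ge0.
have b3 : `|2 * z * c^-1 * F1| <= 2 * Z * (`|G1| + K1 * E) * e.
  rewrite !normrM (ger0_norm ci0) [`|2|]ger0_norm// mulrAC.
  apply: ler_pM; [by rewrite !mulr_ge0|by []| |exact: e3].
  apply: ler_pM; [by rewrite mulr_ge0|by []| |exact: F1b].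
  by rewrite ler_wpM2l.
have b4 : `|2 * z * (F0 - G0)| <= 2 * Z * K0 * e.
  rewrite !normrM [`|2|]ger0_norm// -[leRHS]mulrA; apply: ler_pM; rewrite ?mulr_ge0//.
  by rewrite ler_wpM2l.
have b5 : `|2 * (s' - s) * G0| <= 2 * `|G0| * e.
  by rewrite !normrM [`|2|]ger0_norm// distrC mulrAC ler_wpM2l// mulr_ge0.
set C := 2 * Z * (`|G1| + K1 * E) in b3 *.
have -> : (2 * X * K1 + 2 * `|G1| + C + 2 * Z * K0 + 2 * `|G0|) * e =
  2 * X * K1 * e + 2 * `|G1| * e + C * e + 2 * Z * K0 * e + 2 * `|G0| * e by ring.
apply: le_trans (ler_normB _ _) _; apply: lerD b5; apply: le_trans (ler_normB _ _) _.
apply: lerD b4; apply: le_trans (ler_normD _ _) _; apply: lerD b3.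
by apply: le_trans (ler_normD _ _) _; exact: lerD.
Qed.

(** The induction carries two consecutive k. The start k = 1 is [scaled_charlier_cvg0] at s - 1 and
    s' - 1, renormalised by Gamma(s) = (s - 1) Gamma(s - 1) and [hermite_constS]; the range 3 <= s
    leaves s - 1 >= 2 for it. *)
Lemma scaled_charlier_cvg X x s' k : 0 <= X -> `|x| <= X -> 4 <= s' <= 5 ->
  exists2 K, 0 <= K & forall c n xi s, near_regime X c n xi -> 3 <= s <= 6 ->
  `|euler_gamma s * scaled_charlier c n (k%:R - s) -
    hermite (k%:R - s') x / hermite_const s'| <= K * (c^-1 + `|s - s'| + `|xi - x|).
Proof.
move=> X0 xX s'45; pose P k := exists2 K, 0 <= K &
  forall c n xi s, near_regime X c n xi -> 3 <= s <= 6 ->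
  `|euler_gamma s * scaled_charlier c n (k%:R - s) -
    hermite (k%:R - s') x / hermite_const s'| <= K * (c^-1 + `|s - s'| + `|xi - x|).
have hc0 : hermite_const s' != 0 by rewrite gt_eqF// hermite_const_gt0//; lra.
suff [] : P k /\ P k.+1 by [].
elim: k => [|k [[K0 K00 h0] [K1 K10 h1]]]; last first.
  split; first by exists K1.
  have [K Kp hK] := @scaled_charlier_cvg_step X x s' k K0 K1
    (hermite (k%:R - s') x / hermite_const s')
    (hermite (k.+1%:R - s') x / hermite_const s') X0 xX s'45 K00 K10.
  exists K => // c n xi s reg s36; have := hK c n xi s reg s36 (h0 _ _ _ _ reg s36) (h1 _ _ _ _ reg s36).
  have -> // : hermite (k.+2%:R - s') x / hermite_const s' =
   2 * x * (hermite (k.+1%:R - s') x / hermite_const s') -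
   2 * (k.+1%:R - s') * (hermite (k%:R - s') x / hermite_const s').
  have := hermiteS (k.+1%:R - s') x.
  have -> : k.+1%:R - s' + 1 = k.+2%:R - s' by rewrite -[k.+2%:R]natr1; ring.
  have -> : k.+1%:R - s' - 1 = k%:R - s' by rewrite -[k.+1%:R]natr1; ring.
  by move=> ->; ring.
split.
  have [|K K0 hK] := @scaled_charlier_cvg0 X x s' X0 xX; first by lra.
  exists K => // c n xi s reg s36; rewrite !sub0r hermite_Int; last by lra.
  by rewrite mulrAC divff// mul1r; apply: hK => //; lra.
have [|K K0 hK] := @scaled_charlier_cvg0 X x (s' - 1) X0 xX; first by lra.
pose G := Int (weber_fun x (s' - 1)).
exists (5 * K + `|G|); first by rewrite addr_ge0// mulr_ge0.
move=> c n xi s reg s36.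
have -> : 1%:R - s' = - (s' - 1) by ring.
rewrite hermite_Int; last by lra.
rewrite hermite_constS; last by lra.
rewrite subrK -/G.
have -> : (s' - 1) * hermite_const s' * G / hermite_const s' = (s' - 1) * G by field.
have -> : 1%:R - s = - (s - 1) by ring.
have -> : euler_gamma s = (s - 1) * euler_gamma (s - 1).
  by rewrite -euler_gammaS ?subrK//; lra.
set F := scaled_charlier _ _ _.
have -> : (s - 1) * euler_gamma (s - 1) * F - (s' - 1) * G =
   (s - 1) * (euler_gamma (s - 1) * F - G) + (s - s') * G by ring.
have := hK c n xi (s - 1) reg ltac:(lra).
rewrite -/F -/G; have -> : s - 1 - (s' - 1) = s - s' by ring.
set e := c^-1 + _ + _ => he.
have c0 : 0 < c by have [_ + _] := reg; lra.
have e2 : `|s - s'| <= e.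
  have ci0 : 0 <= c^-1 by rewrite invr_ge0 ltW.
  have : 0 <= `|xi - x| by []. rewrite /e; lra.
rewrite [leRHS]mulrDl (le_trans (ler_normD _ _))// lerD//.
  rewrite normrM -[leRHS]mulrA; apply: ler_pM => //.
  by rewrite ger0_norm; lra.
by rewrite normrM mulrC ler_wpM2l.
Qed.

(** rho(z) = Gamma(k + 1 - z) is the factor inherited from the integral. It is the same at z and z -
    1, because s = k + 1 - z is fixed while k drops by one. *)
Lemma charlier_hermite_asymp X x nu : 0 <= X -> `|x| <= X -> 0 <= nu ->
  exists rho : R -> R, exists kappa K : R,
  [/\ 0 < kappa, 0 <= K, forall z, `|z - nu| <= 1 -> 0 < rho z &
    forall c n xi z, near_regime X c n xi -> `|z - nu| <= 1 ->
    `|rho z * scaled_charlier c n z - kappa * hermite nu x| <=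
      K * (c^-1 + `|z - nu| + `|xi - x|) /\
    `|rho z * scaled_charlier c n (z - 1) - kappa * hermite (nu - 1) x| <=
      K * (c^-1 + `|z - nu| + `|xi - x|)].
Proof.
move=> X0 xX nu0.
(* With this shift s' = k + 1 - nu lies in (4, 5], and |z - nu| <= 1 keeps k + 1 - z in [3, 6]. *)
pose k := (Num.truncn nu + 4)%N.
pose s' := k.+1%:R - nu.
have s'45 : 4 <= s' <= 5.
  have := truncn_le nu; have := truncnS_gt nu; rewrite nu0 /s' /k.
  by rewrite -!natr1 natrD; lra.
have [K1 K10 h1] := @scaled_charlier_cvg X x s' k X0 xX s'45.
have [K2 K20 h2] := @scaled_charlier_cvg X x s' k.+1 X0 xX s'45.
exists (fun z => euler_gamma (k.+1%:R - z)), (hermite_const s')^-1, (K1 + K2).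
have sz z : `|z - nu| <= 1 -> 3 <= k.+1%:R - z <= 6.
  rewrite ler_norml; move: s'45; rewrite /s'; lra.
split.
- by rewrite invr_gt0 hermite_const_gt0//; lra.
- by rewrite addr_ge0.
- by move=> z /sz z36; rewrite euler_gamma_gt0//; lra.
move=> c n xi z reg z1; have z36 := sz z z1.
have := h1 c n xi _ reg z36; have := h2 c n xi _ reg z36.
have -> : k.+1%:R - (k.+1%:R - z) = z by ring.
have -> : k.+1%:R - s' = nu by rewrite /s'; ring.
have -> : k%:R - (k.+1%:R - z) = z - 1 by rewrite -natr1; ring.
have -> : k%:R - s' = nu - 1 by rewrite /s' -natr1; ring.
have -> : k.+1%:R - z - s' = - (z - nu) by rewrite /s'; ring.
rewrite normrN [_^-1 * hermite nu x]mulrC [_^-1 * hermite (nu - 1) x]mulrC.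
have [c2 ci0] : 2 <= c /\ 0 <= c^-1.
  have [_ + _] := reg => cX; have : 0 < c by lra.
  by move=> /ltW c0; rewrite invr_ge0 c0; split => //; lra.
have e0 : 0 <= c^-1 + `|z - nu| + `|xi - x| by rewrite !addr_ge0.
move=> b1 b2; split; rewrite [leRHS]mulrDl.
  by rewrite (le_trans b1)// lerDr mulr_ge0.
by rewrite (le_trans b2)// lerDl mulr_ge0.
Qed.

(** Two consecutive zeros propagate downwards by the recurrence. Its last coefficient vanishes only
    at index 0, where [hermite0_neq0] contradicts the assumed zero. Far down the function is a
    positive multiple of a positive integral. *)
Lemma hermite_consecutive nu x : hermite nu x = 0 -> hermite (nu - 1) x != 0.
Proof.
move=> h0; apply/eqP => h1.
have hk k : hermite (nu - k%:R) x = 0 /\ hermite (nu - k%:R - 1) x = 0.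
  elim: k => [|k [IH1 IH2]]; first by rewrite subr0.
  have e : nu - k.+1%:R = nu - k%:R - 1 by rewrite -natr1; ring.
  rewrite e; split => //; set mu := nu - k%:R - 1 in IH2 *.
  have := hermiteS mu x.
  rewrite IH2 /mu subrK IH1 mulr0 sub0r => /esym/eqP; rewrite oppr_eq0 2!mulf_eq0.
  move=> /orP[/orP[|/eqP m0]|/eqP h]; [by rewrite pnatr_eq0| |exact: h].
  move: IH2; rewrite (_ : mu = 0)// => /eqP.
  by rewrite (negPf (hermite0_neq0 x)).
pose N := Num.bound `|nu + 2|.
have kb : nu + 2 < N%:R by rewrite (le_lt_trans (ler_norm _))// archi_boundP.
have [+ _] := hk N; rewrite (_ : nu - N%:R = - (N%:R - nu)); last by ring.
rewrite hermite_Int; last by lra.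
move=> /eqP; rewrite mulf_eq0 !gt_eqF//.
  by apply: Int_weber_gt0; lra.
by apply: hermite_const_gt0; lra.
Qed.

End asymptotics.

(** * Zeros *)

Section ratio.
Variable R : realType.
Implicit Types (a c z : R) (n k m M : nat).

(** Pair y_m with y_(M+m): they differ by at least Mb, and p^2 + q^2 >= (p - q)^2/2. The sum is thus
    of order M^3 b^2 even if y changes sign. *)
Lemma sum_sqr_ge (y : nat -> R) M b : 0 <= b ->
  (forall m, (m < M + M)%N -> b <= y m.+1 - y m) ->
  M%:R * (M%:R * b) ^+ 2 / 2 <= \sum_(m < M + M) y m ^+ 2.
Proof.
move=> b0 yb.
have yj m j : (m + j <= M + M)%N -> j%:R * b <= y (m + j)%N - y m.
  elim: j => [|j IH] mj; first by rewrite addn0 subrr mul0r.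
  have := IH (leq_trans (leq_add (leqnn m) (leqnSn j)) mj).
  have := yb (m + j)%N; rewrite -addnS => /(_ mj).
  by rewrite -natr1 mulrDl; lra.
rewrite big_split_ord/= -big_split/=.
apply: (@le_trans _ _ (\sum_(m < M) (M%:R * b) ^+ 2 / 2)).
  by rewrite sumr_const card_ord -[leRHS]mulr_natl -[leLHS]mulrA.
apply: ler_sum => m _.
have := @yj m M; rewrite leq_add2r (ltnW (ltn_ord m)) addnC => /(_ isT) h.
have hb : 0 <= M%:R * b by rewrite mulr_ge0.
have : (M%:R * b) ^+ 2 <= (y (M + m)%N - y m) ^+ 2.
  by rewrite ler_sqr ?nnegrE// (le_trans hb).
have := sqr_ge0 (y (M + m)%N + y m).
move: (M%:R * b) (y (M + m)%N) (y m) => p q r; nra.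
Qed.

Definition poisson_weight a k : R := a ^+ k / k`!%:R.

Lemma poisson_weight_gt0 a k : 0 < a -> 0 < poisson_weight a k.
Proof. by move=> a0; rewrite divr_gt0 ?exprn_gt0// ltr0n fact_gt0. Qed.

Lemma poisson_weightS a k : a != 0 ->
  poisson_weight a k = k.+1%:R / a * poisson_weight a k.+1.
Proof.
move=> a0; rewrite /poisson_weight factS natrM exprS; field.
have fk : k`!%:R != 0 :> R by rewrite pnatr_eq0 -lt0n fact_gt0.
by rewrite a0 fk nat1r pnatr_eq0.
Qed.

(** Each step down multiplies the weight by some (n - j)/a >= 1 - t, and Bernoulli's inequality
    bounds the product. With t of order 1/c the weights stay comparable over about c degrees. *)
Lemma poisson_weight_ge a n m (t : R) : 0 < a -> (m <= n)%N ->
  (a - n%:R + m%:R) / a <= t -> m%:R * t <= 1 -> 0 <= t ->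
  (1 - m%:R * t) * poisson_weight a n <= poisson_weight a (n - m).
Proof.
move=> a0 mn; have wn := poisson_weight_gt0 n a0.
elim: m mn => [|m IH] mn tm mt t0; first by rewrite subn0 mul0r subr0 mul1r.
have mt' : m%:R * t <= 1.
  by rewrite (le_trans _ mt)// ler_wpM2r// ler_nat.
have h : (1 - m%:R * t) * poisson_weight a n <= poisson_weight a (n - m).
  apply: IH => //; first exact: ltnW.
  by rewrite (le_trans _ tm)// ler_pM2r ?invr_gt0// lerD2l ler_nat.
have e : (n - m.+1).+1 = (n - m)%N by rewrite -subSn.
rewrite [leRHS]poisson_weightS ?gt_eqF// e.
have q : 1 - t <= (n - m)%:R / a.
  rewrite natrB ?(ltnW mn)//.
  have -> : (n%:R - m%:R) / a = 1 - (a - n%:R + m.+1%:R) / a + a^-1.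
    by rewrite -natr1; field; rewrite gt_eqF.
  have : 0 < a^-1 by rewrite invr_gt0.
  lra.
apply: (@le_trans _ _ ((1 - t) * ((1 - m%:R * t) * poisson_weight a n))).
  rewrite mulrA ler_wpM2r ?(ltW wn)// -natr1.
  have : 0 <= m%:R * t * t by rewrite !mulr_ge0.
  lra.
have [t1|t1] := leP t 1.
  by apply: ler_pM => //; rewrite ?subr_ge0// mulr_ge0 ?subr_ge0// ltW.
apply: (@le_trans _ _ 0).
  by rewrite mulr_le0_ge0//; [lra|rewrite mulr_ge0 ?subr_ge0// ltW].
have := ltW (poisson_weight_gt0 (n - m) a0); have := ltW a0 => ? ?.
by rewrite mulr_ge0// divr_ge0.
Qed.

(* z c_n(z - 1) = a (c_n(z) - c_(n+1)(z)), so that the derivative of [charlier_ratio]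
   is a Christoffel--Darboux sum and has constant sign; unlike c_n, this
   denominator stays away from 0, after scaling, near the zeros of c_(n+1). *)
Definition charlier_den a n z : R := z * charlier a n (z - 1).

Definition charlier_ratio a n z : R := charlier a n.+1 z / charlier_den a n z.

Lemma charlier_denE a n z : a != 0 ->
  charlier_den a n z = a * (charlier a n z - charlier a n.+1 z).
Proof. by move=> a0; rewrite -[_ - _]opprB charlierSn// /charlier_den; field. Qed.

(** Since the denominator equals a (c_n - c_(n+1)), the products c_(n+1) c'_(n+1) cancel in the
    quotient rule and the Wronskian of [charlier_wronskian] remains. *)
Lemma is_derive_charlier_ratio a n z : a != 0 -> charlier_den a n z != 0 ->
  is_derive z 1 (charlier_ratio a n)
    (- (a / n.+1%:R) * (\sum_(k < n.+1) poisson_weight a k / poisson_weight a n.+1 *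
       (charlier a k z / charlier_den a n z) ^+ 2)).
Proof.
move=> a0 d0.
have -> : \sum_(k < n.+1) poisson_weight a k / poisson_weight a n.+1 *
    (charlier a k z / charlier_den a n z) ^+ 2 =
  (\sum_(k < n.+1) a ^+ k / k`!%:R * charlier a k z ^+ 2) /
    (poisson_weight a n.+1 * charlier_den a n z ^+ 2).
  rewrite mulr_suml; apply: eq_bigr => k _.
  by rewrite -/(poisson_weight a k) expr_div_n mulf_div.
rewrite charlier_wronskian//.
have -> : charlier_ratio a n = (fun z => charlier a n.+1 z / (a * (charlier a n z - charlier a n.+1 z))).
  by apply/funext => t; rewrite /charlier_ratio charlier_denE.
rewrite charlier_denE// in d0 *.
have h0 := is_derive_charlier a n z; have h1 := is_derive_charlier a n.+1 z.
apply: is_derive_eq.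
rewrite /GRing.scale /poisson_weight/= factS natrM.
have fk : n`!%:R != 0 :> R by rewrite pnatr_eq0 -lt0n fact_gt0.
have ak : a ^+ n.+1 != 0 by rewrite expf_neq0.
have n1 : n.+1%:R != 0 :> R by rewrite pnatr_eq0.
have cc : charlier a n z - charlier a n.+1 z != 0.
  by apply: contraNneq d0 => ->; rewrite mulr0.
move: (a ^+ n.+1) ak (n.+1%:R) n1 (n`!%:R) fk => p p0 q q0 r r0.
by field; rewrite p0 q0 r0 cc a0.
Qed.

End ratio.

(** * Uniform negative slope of the ratio *)

Section slope.
Variable R : realType.
Implicit Types (c x xi z nu X r sg g : R) (n m M : nat).

Lemma scaled_charlier_diff c n z : 0 < c ->
  scaled_charlier c n z - scaled_charlier c n.+1 z = 2 * z / c * scaled_charlier c n (z - 1).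
Proof.
move=> c0; rewrite /scaled_charlier -mulrBr; set a := c ^+ 2 / 2.
have cn0 : c != 0 by rewrite gt_eqF.
have a0 : a != 0 by rewrite gt_eqF// divr_gt0// exprn_gt0.
have -> : charlier a n z - charlier a n.+1 z = z / a * charlier a n (z - 1).
  by rewrite -[LHS]opprB charlierSn//; ring.
have -> : c `^ z = c * c `^ (z - 1) by rewrite mulrC -[X in _ * X]expr1 powR_mulX// subrK.
by rewrite /a; field.
Qed.

Lemma charlier_over_den c n k z : 0 < c -> z != 0 -> charlier (c ^+ 2 / 2) n (z - 1) != 0 ->
  charlier (c ^+ 2 / 2) k z / charlier_den (c ^+ 2 / 2) n z =
  scaled_charlier c k z / (z * c * scaled_charlier c n (z - 1)).
Proof.
move=> c0 z0 d0; rewrite /scaled_charlier /charlier_den.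
have -> : c `^ z = c * c `^ (z - 1) by rewrite mulrC -[X in _ * X]expr1 powR_mulX// subrK.
have p0 : c `^ (z - 1) != 0 by rewrite gt_eqF// powR_gt0.
have cn0 : c != 0 by rewrite gt_eqF.
by field; rewrite ?z0 ?cn0 ?p0 ?d0.
Qed.

(** Going down in degree, the scaled values at z grow by at least zg/c per step, so [sum_sqr_ge]
    bounds 2M terms of the derivative sum from below, whatever the values themselves. The constant
    18 is 2 * 2 * 2 * 9/4: halves from the weights, from [sum_sqr_ge] and from a/(n+1) >= 1/2, and
    (g/Y)^2 >= (2/3)^2. *)
Lemma charlier_ratio_derive_le c n M z r sg g (a := c ^+ 2 / 2) :
  0 < c -> 0 < z -> sg * sg = 1 -> 0 < r -> 0 < g -> (M + M <= n)%N ->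
  n.+1%:R <= c ^+ 2 ->
  (forall m, (m <= M + M)%N -> g / 2 <= sg * (r * scaled_charlier c (n - m) (z - 1)) <= 3 * g / 2) ->
  (forall m, (m < M + M)%N -> 2^-1 <= poisson_weight a (n - m) / poisson_weight a n.+1) ->
  exists2 d, is_derive z 1 (charlier_ratio a n) d & c * d <= - ((M%:R / c) ^+ 3 / 18).
Proof.
move=> c0 z0 sg1 r0 g0 Mn nc hg hw.
have a_gt0 : 0 < a by rewrite divr_gt0// exprn_gt0.
have a0 : a != 0 by rewrite gt_eqF.
have cn0 : c != 0 by rewrite gt_eqF.
have zn0 : z != 0 by rewrite gt_eqF.
have := hg 0%N isT; rewrite subn0; set Y := sg * _ => /andP[Y1 Y2].
have Y0 : 0 < Y by lra.
have d0 : charlier a n (z - 1) != 0.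
  apply: contraTneq Y0 => h; rewrite /Y /scaled_charlier -/a h.
  by rewrite !mulr0 ltxx.
have den0 : charlier_den a n z != 0 by rewrite mulf_neq0.
eexists; first exact: is_derive_charlier_ratio.
pose y m := sg * (r * scaled_charlier c (n - m) z).
have sr0 : sg * r != 0.
  rewrite mulf_neq0 ?(gt_eqF r0)//; apply: contra_eq_neq sg1 => ->.
  by rewrite mulr0 eq_sym oner_neq0.
have qE m : charlier a (n - m) z / charlier_den a n z = y m / (z * c * Y).
  rewrite charlier_over_den// /y /Y.
  have s0 : scaled_charlier c n (z - 1) != 0.
    by rewrite mulf_neq0// gt_eqF// powR_gt0.
  move: sr0; rewrite mulf_eq0 negb_or => /andP[sg0 rn0].
  by field; rewrite zn0 cn0 s0 sg0 rn0.
have ystep m : (m < M + M)%N -> z * g / c <= y m.+1 - y m.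
  move=> mM; have mn : (m < n)%N by rewrite (leq_trans mM).
  have e : (n - m)%N = (n - m.+1).+1 by rewrite -subSn.
  have -> : y m.+1 - y m = 2 * z / c * (sg * (r * scaled_charlier c (n - m.+1) (z - 1))).
    by rewrite /y e -2!mulrBr scaled_charlier_diff//; ring.
  have /andP[h _] := hg m.+1 mM.
  have -> : z * g / c = 2 * z / c * (g / 2) by field.
  by rewrite ler_wpM2l// divr_ge0 ?ltW// mulr_gt0.
have zgc : 0 <= z * g / c by rewrite divr_ge0 ?ltW// mulr_gt0.
have S1 := sum_sqr_ge zgc ystep.
pose F k := poisson_weight a k / poisson_weight a n.+1 * (charlier a k z / charlier_den a n z) ^+ 2.
have F0 k : 0 <= F k.
  by rewrite mulr_ge0 ?sqr_ge0// divr_ge0// ltW// poisson_weight_gt0.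
have S2 : \sum_(m < M + M) F (n - m)%N <= \sum_(k < n.+1) F k.
  rewrite [leRHS](reindex_inj rev_ord_inj)/=.
  under [leRHS]eq_bigr do rewrite subSS.
  rewrite (big_ord_widen n.+1 (fun m => F (n - m)%N)); last by rewrite (leq_trans Mn).
  by rewrite [leRHS](bigID (fun m : 'I__ => (m < M + M)%N))/= lerDl sumr_ge0.
have S3 : 2^-1 * ((z * c * Y) ^-1) ^+ 2 * \sum_(m < M + M) y m ^+ 2 <= \sum_(m < M + M) F (n - m)%N.
  rewrite mulr_sumr; apply: ler_sum => m _.
  rewrite /F qE -mulrA -exprMn [_^-1 * y m]mulrC ler_wpM2r ?sqr_ge0//.
  exact: hw.
have zcY : 0 < z * c * Y := mulr_gt0 (mulr_gt0 z0 c0) Y0.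
have Yn0 : Y != 0 by rewrite gt_eqF.
have S4 : M%:R * (M%:R / c) ^+ 2 / (9 * c ^+ 2) <= \sum_(k < n.+1) F k.
  apply: le_trans S2; apply: le_trans S3.
  apply: (@le_trans _ _ (2^-1 * (z * c * Y)^-1 ^+ 2 * (M%:R * (M%:R * (z * g / c)) ^+ 2 / 2))); last first.
    by rewrite ler_wpM2l// mulr_ge0// sqr_ge0.
  have -> : 2^-1 * (z * c * Y)^-1 ^+ 2 * (M%:R * (M%:R * (z * g / c)) ^+ 2 / 2) =
      M%:R * (M%:R / c) ^+ 2 / (4 * c ^+ 2) * (g / Y) ^+ 2.
    by field; rewrite ?zn0 ?cn0 ?Yn0.
  have -> : M%:R * (M%:R / c) ^+ 2 / (9 * c ^+ 2) = M%:R * (M%:R / c) ^+ 2 / (4 * c ^+ 2) * (2 / 3) ^+ 2.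
    by field.
  rewrite ler_wpM2l//.
    by apply: divr_ge0; apply: mulr_ge0 => //; exact: sqr_ge0.
  rewrite ler_sqr ?nnegrE ?divr_ge0 ?(ltW g0) ?(ltW Y0)//.
  by rewrite ler_pdivlMr//; lra.
have -> : (M%:R / c) ^+ 3 / 18 = c * 2^-1 * (M%:R * (M%:R / c) ^+ 2 / (9 * c ^+ 2)) by field.
rewrite mulNr mulrN lerN2 -mulrA ler_pM2l//.
apply: ler_pM => //; first by apply: divr_ge0; apply: mulr_ge0 => //; exact: sqr_ge0.
rewrite ler_pdivlMr// mulrC /a; lra.
Qed.

(** The sign of c_n(z - 1) is recorded because it is constant near nu: the ratio then has no pole
    there, and its sign determines that of c_(n+1). *)
Lemma charlier_ratio_slope x nu : 0 < nu -> hermite (nu - 1) x != 0 ->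
  exists eta mu c1 C : R, [/\ 0 < eta, 0 < mu, 0 < c1, 0 <= C &
  forall c n xi, c1 <= c -> n.+1%:R = c ^+ 2 / 2 - xi * c -> `|xi - x| <= eta ->
  (hermite nu x = 0 -> `|c * charlier_ratio (c ^+ 2 / 2) n nu| <= C * (c^-1 + `|xi - x|)) /\
  (forall z, `|z - nu| <= eta -> [/\ 0 < z,
     0 < Num.sg (hermite (nu - 1) x) * charlier (c ^+ 2 / 2) n (z - 1) &
     exists2 d, is_derive z 1 (charlier_ratio (c ^+ 2 / 2) n) d & c * d <= - mu])].
Proof.
move=> nu0 H0.
have [X XE] : exists X, X = `|x| + 1 by exists (`|x| + 1).
have X1 : 1 <= X by rewrite XE lerDr.
have X0 : 0 <= X by exact: le_trans X1.
have xX : `|x| <= X by rewrite XE lerDl.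
have [rho [kappa [K [kappa0 K0 rho0 hK]]]] := charlier_hermite_asymp X0 xX (ltW nu0).
have [g gE] : exists g, g = kappa * `|hermite (nu - 1) x| by eexists.
have g0 : 0 < g by rewrite gE mulr_gt0// normr_gt0.
set sg := Num.sg (hermite (nu - 1) x).
have sg1 : sg * sg = 1 by rewrite -expr2 sqr_sg H0.
have sgn : `|sg| = 1 by rewrite normr_sg H0.
have {}gE : g = sg * (kappa * hermite (nu - 1) x).
  by rewrite gE normrEsg -/sg; ring.
clearbody sg.
(* The three bounds on e0 keep |z - nu| <= 1, keep z positive, and make the three error terms of the
   asymptotics, each at most K e0, add up to at most g/2. *)
have [e0 [e00 e0a e0b e0c]] : exists e0,
    [/\ 0 < e0, e0 <= 2^-1, e0 <= nu / 2 & 3 * (K * e0) <= g / 2].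
  exists (Num.min (Num.min 2^-1 (nu / 2)) (g / (6 * (K + 1)))).
  set e := Num.min _ _.
  have K1 : 0 < K + 1 by rewrite ltr_wpDl.
  have e_gt0 : 0 < e.
    by rewrite !lt_min invr_gt0 ltr0n (divr_gt0 nu0)// (divr_gt0 g0)// mulr_gt0.
  split=> //; rewrite ?ge_min ?lexx ?orbT//.
  have : e <= g / (6 * (K + 1)) by rewrite !ge_min lexx ?orbT.
  rewrite ler_pdivlMr ?mulr_gt0//; clearbody e; lra.
(* The window will have 2M degrees with M the integer part of ga c. The bound e0/8 limits the drift
   2M/c of xi to e0/4; the other one keeps the weights in the window above half of that at n + 1. *)
have [ga [ga0 gaa gab]] : exists ga,
    [/\ 0 < ga, ga <= e0 / 8 & ga * (8 * (X + 1)) <= 1].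
  have X10 : 0 < 8 * (X + 1) by rewrite mulr_gt0// ltr_wpDl.
  exists (Num.min (e0 / 8) ((8 * (X + 1))^-1)); split.
  - by rewrite lt_min invr_gt0 X10 (divr_gt0 e00).
  - by rewrite ge_min lexx.
  - by rewrite -ler_pdivlMr// mul1r ge_min lexx orbT.
have e0i : 0 < 4 / e0 by rewrite divr_gt0.
have gai : 0 < 2 / ga by rewrite divr_gt0.
(* 4/e0 gives 1/c <= e0/4, and 2/ga gives ga c >= 2, so that M >= ga c/2; this is where ga/2 in the
   slope comes from. *)
have [c1 [c1_gt0 c1X c1e c1g]] : exists c1,
    [/\ 0 < c1, 2 * (2 * X + 1) <= c1, 4 / e0 <= c1 & 2 / ga <= c1].
  by exists (2 * (2 * X + 1) + 4 / e0 + 2 / ga); clear -X1 e0i gai; split; lra.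
exists (e0 / 2), ((ga / 2) ^+ 3 / 18), c1, (K / (nu * (g / 2))); split.
- by rewrite divr_gt0.
- by rewrite divr_gt0// exprn_gt0// divr_gt0.
- exact: c1_gt0.
- by rewrite divr_ge0// mulr_ge0 ?divr_ge0 ?ltW.
move=> c n xi c1c nE xix.
have c0 : 0 < c := lt_le_trans c1_gt0 c1c.
have Xc : 2 * (2 * X + 1) <= c := le_trans c1X c1c.
have ci : c^-1 <= e0 / 4.
  by rewrite -[e0 / 4]invrK invf_div lef_pV2 ?posrE// (le_trans c1e).
have gac : 2 <= ga * c by rewrite mulrC -ler_pdivrMr// (le_trans c1g).
clear c1 c1_gt0 c1X c1e c1g c1c e0i gai.
have cn0 : c != 0 by rewrite gt_eqF.
have xiX : `|xi| <= X.
  have -> : xi = x + (xi - x) by ring.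
  by rewrite XE (le_trans (ler_normD _ _))// lerD2l; lra.
pose M := Num.truncn (ga * c).
have gac0 : 0 <= ga * c by rewrite mulr_ge0 ?ltW.
have /andP[M1 M2] : M%:R <= ga * c < M.+1%:R by apply: truncn_itv.
rewrite -natr1 in M2; clearbody M.
have reg1 : near_regime X c n.+1 xi by [].
have gaX : ga <= 16^-1.
  by clear -gaa e0a; lra.
have gacc : ga * c <= 16^-1 * c by rewrite ler_pM2r.
have n2M : (M + M <= n)%N.
  rewrite -(ler_nat R) natrD -(lerD2r 1) [n%:R + 1]natr1 nE.
  have : xi * c <= X * c by rewrite ler_pM2r// (le_trans (ler_norm _)).
  have : 0 <= (c - 2 * (2 * X + 1)) * c by rewrite mulr_ge0 ?subr_ge0// ltW.
  have : c <= X * c by rewrite ler_peMl// ltW.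
  nra.
have nc : n.+1%:R <= c ^+ 2.
  rewrite nE; have : - xi * c <= X * c.
    by rewrite ler_pM2r// (le_trans (ler_norm _))// normrN.
  have : 0 <= (c - 2 * (2 * X + 1)) * c by rewrite mulr_ge0 ?subr_ge0// ltW.
  nra.
(* xi belongs to degree n + 1, so degree n - m lies m + 1 steps below it. *)
pose xim m := xi + m.+1%:R / c.
have regm m : (m <= M + M)%N -> near_regime X c (n - m) (xim m) /\ `|xim m - x| <= e0.
  move=> mM; have mn : (m <= n)%N by rewrite (leq_trans mM).
  have mc : m.+1%:R / c <= e0 / 2.
    rewrite -natr1 mulrDl div1r.
    have : m%:R / c <= e0 / 4.
      rewrite ler_pdivrMr//.
      have : m%:R <= M%:R + M%:R :> R by rewrite -natrD ler_nat.
      have : ga * c <= e0 / 8 * c by rewrite ler_pM2r.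
      lra.
    lra.
  have mc0 : 0 <= m.+1%:R / c by rewrite divr_ge0// ltW.
  have h : `|xim m - x| <= e0.
    have -> : xim m - x = (xi - x) + m.+1%:R / c by rewrite /xim; ring.
    rewrite (le_trans (ler_normD _ _))// (ger0_norm mc0).
    by clear -mc xix; lra.
  split => //; split => //.
    have -> : xim m = x + (xim m - x) by ring.
    rewrite XE (le_trans (ler_normD _ _))// lerD2l (le_trans h)//.
    by clear -e0a; lra.
  rewrite natrB// /xim mulrDl divfK// opprD addrA -nE -!natr1; ring.
have hg z m : `|z - nu| <= e0 / 2 -> (m <= M + M)%N ->
    g / 2 <= sg * (rho z * scaled_charlier c (n - m) (z - 1)) <= 3 * g / 2.
  move=> zn mM; have [rm xm] := regm m mM.
  have z1 : `|z - nu| <= 1 by clear -zn e0a; lra.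
  have [_ h] := hK c (n - m)%N (xim m) z rm z1.
  have : `|sg * (rho z * scaled_charlier c (n - m) (z - 1)) - g| <= g / 2.
    rewrite [X in _ - X]gE -mulrBr normrM sgn mul1r (le_trans h)// (le_trans _ e0c)//.
    have -> : 3 * (K * e0) = K * (3 * e0) by ring.
    by rewrite ler_wpM2l//; clear -ci zn xm e00; lra.
  move: (sg * _) => y; rewrite ler_norml; clear; lra.
split.
  move=> hz.
  have nn : `|nu - nu| <= e0 / 2 by rewrite subrr normr0 divr_ge0 ?ltW.
  have n1 : `|nu - nu| <= 1 by rewrite subrr normr0.
  have [h _] := hK c n.+1 xi nu reg1 n1.
  rewrite hz mulr0 subr0 subrr normr0 addr0 in h.
  have /andP[l _] := hg nu 0%N nn isT; rewrite subn0 in l.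
  have rn := rho0 nu n1.
  set D := rho nu * scaled_charlier c n (nu - 1) in l.
  have Dg : g / 2 <= `|D|.
    by rewrite (le_trans l)// (le_trans (ler_norm _))// normrM sgn mul1r.
  have D0 : D != 0 by rewrite -normr_gt0 (lt_le_trans _ Dg)// divr_gt0.
  have c_n0 : charlier (c ^+ 2 / 2) n (nu - 1) != 0.
    apply: contraNneq D0 => e; rewrite /D /scaled_charlier e.
    by rewrite !mulr0.
  have s0 : scaled_charlier c n (nu - 1) != 0.
    by apply: contraNneq D0 => e; rewrite /D e mulr0.
  have nun0 : nu != 0 by rewrite gt_eqF.
  have -> : c * charlier_ratio (c ^+ 2 / 2) n nu =
      rho nu * scaled_charlier c n.+1 nu / (nu * D).
    rewrite /charlier_ratio charlier_over_den// /D.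
    by field; rewrite s0 cn0 nun0 gt_eqF.
  rewrite normrM normfV [`|nu * D|]normrM (gtr0_norm nu0) mulrAC.
  apply: ler_pM => //; first by rewrite invr_ge0 mulr_ge0// ltW.
  have g2 : 0 < g / 2 by rewrite divr_gt0.
  have Dn : 0 < `|D| by rewrite normr_gt0.
  by rewrite lef_pV2 ?posrE ?mulr_gt0// ler_pM2l.
move=> z zn.
have z0 : 0 < z by move: zn; rewrite ler_norml; clear -e0b nu0; lra.
have z1 : `|z - nu| <= 1 by clear -zn e0a; lra.
have rz := rho0 z z1.
split => //.
  have /andP[l _] := hg z 0%N zn isT; rewrite subn0 in l.
  have : 0 < sg * (rho z * scaled_charlier c n (z - 1)).
    by rewrite (lt_le_trans _ l)// divr_gt0.
  have p0 : 0 < rho z * c `^ (z - 1) by rewrite mulr_gt0// powR_gt0.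
  have -> : sg * (rho z * scaled_charlier c n (z - 1)) =
    rho z * c `^ (z - 1) * (sg * charlier (c ^+ 2 / 2) n (z - 1)).
    by rewrite /scaled_charlier; ring.
  by rewrite (pmulr_rgt0 _ p0).
have [||d dd dle] := @charlier_ratio_derive_le c n M z (rho z) sg g c0 z0 sg1 rz g0 n2M nc.
- by move=> m; exact: hg.
- move=> m mM; clear -c0 cn0 Xc gac0 gacc M1 mM n2M nE xiX X0 gab.
  (* For a = c^2/2 the relative deficit (xi c + m + 1)/a is at most (X + 1) c/a = t, because m + 1
     <= 2 ga c <= c; and (m + 1) t <= 1/2 by the choice of ga. *)
  pose t := 2 * (X + 1) / c.
  have a0 : 0 < c ^+ 2 / 2 by rewrite divr_gt0// exprn_gt0.
  have mc : m.+1%:R <= 2 * (ga * c).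
    have : m.+1%:R <= M%:R + M%:R :> R by rewrite -natrD ler_nat.
    lra.
  have mt : m.+1%:R * t <= 2^-1.
    rewrite /t mulrA ler_pdivrMr//.
    have : m.+1%:R * (2 * (X + 1)) <= 2 * (ga * c) * (2 * (X + 1)).
      by rewrite ler_wpM2r//; lra.
    have : ga * (8 * (X + 1)) * c <= 1 * c by rewrite ler_pM2r.
    lra.
  have t0 : 0 <= t by rewrite divr_ge0 ?ltW//; lra.
  have mn : (m.+1 <= n.+1)%N by rewrite ltnS (leq_trans (ltnW mM)).
  have := @poisson_weight_ge _ (c ^+ 2 / 2) n.+1 m.+1 t a0 mn.
  rewrite subSS => /(_ _ _ t0) h.
  have w0 := poisson_weight_gt0 n.+1 a0.
  rewrite ler_pdivlMr//; apply: le_trans (h _ _); last by lra.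
    by rewrite ler_wpM2r ?(ltW w0)//; lra.
  rewrite ler_pdivrMr// nE /t.
  have -> : 2 * (X + 1) / c * (c ^+ 2 / 2) = (X + 1) * c by field.
  have : xi * c <= X * c by rewrite ler_pM2r// (le_trans (ler_norm _)).
  lra.
exists d => //; apply: le_trans dle _; rewrite lerN2 ler_pM2r//; clear -M2 gac c0 ga0.
rewrite lerXn2r ?nnegrE ?divr_ge0 ?(ltW ga0) ?(ltW c0)//.
by rewrite ler_pdivlMr//; lra.
Qed.

End slope.

(** * Location of the zeros near [nu] *)

Section zeros.
Variable R : realType.
Implicit Types (c x xi z nu : R) (n : nat).

Lemma charlier_zero_near x nu : 0 < nu -> hermite nu x = 0 ->
  exists eta c1 C : R, [/\ 0 < eta, 0 < c1, 0 < C & forall c n xi, c1 <= c ->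
  n.+1%:R = c ^+ 2 / 2 - xi * c -> `|xi - x| <= c^-1 ->
  (forall z, `|z - nu| <= eta -> charlier (c ^+ 2 / 2) n.+1 z = 0 -> `|nu - z| <= C / c) /\
  (exists2 z, `|nu - z| <= C / c & charlier (c ^+ 2 / 2) n.+1 z = 0)].
Proof.
move=> nu0 hnu.
have [eta [mu [c1 [C [eta0 mu0 c10 C0 H]]]]] :=
  charlier_ratio_slope nu0 (hermite_consecutive hnu).
(* At distance D/c from nu the slope contributes mu D/c = 2C/c + mu/c, which exceeds the bound 2C/c
   on |c Q(nu)|; the factor 2 accounts for |xi - x| <= 1/c. *)
pose D := 2 * C / mu + 1.
have Cmu : 0 <= 2 * C / mu by rewrite divr_ge0 ?mulr_ge0// ltW.
have D0 : 0 < D by rewrite /D; lra.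
have De : 0 < D / eta by rewrite divr_gt0.
have ie : 0 < eta^-1 by rewrite invr_gt0.
exists eta, (c1 + eta^-1 + D / eta), D; split => //; first by lra.
move=> c n xi cc nE xix.
have c0 : 0 < c by lra.
have ceta : c^-1 <= eta by rewrite -[eta]invrK lef_pV2 ?posrE//; lra.
have Deta : D / c <= eta.
  by rewrite ler_pdivrMr// mulrC -ler_pdivrMr//; lra.
have [] := H c n xi ltac:(lra) nE ltac:(lra).
move=> /(_ hnu); set a := c ^+ 2 / 2; set f := charlier_ratio a n.
set sg := Num.sg _ => fnu fd.
have {}fnu : `|c * f nu| <= 2 * C / c.
  apply: (le_trans fnu); have -> : 2 * C / c = C * (c^-1 + c^-1) by ring.
  by rewrite ler_wpM2l// lerD2l.
have mono u v : `|u - nu| <= eta -> `|v - nu| <= eta -> u <= v ->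
    c * f v <= c * f u - mu * (v - u).
  move=> un vn; rewrite le_eqVlt => /predU1P[->|uv]; first by rewrite subrr mulr0 subr0.
  have inn t : u <= t <= v -> `|t - nu| <= eta.
    by move: un vn; rewrite !ler_norml => /andP[? ?] /andP[? ?] /andP[? ?]; lra.
  have dt t : u <= t <= v -> is_derive t 1 f ('D_1 f t) /\ c * 'D_1 f t <= - mu.
    move=> /inn tn; have [_ _ [d dd dm]] := fd t tn.
    have e : 'D_1 f t = d by rewrite derive_val.
    by rewrite e.
  have [||t tuv e] := @MVT R f (fun t => 'D_1 f t) u v uv.
  - by move=> t; rewrite in_itv/= => /andP[/ltW ut /ltW tv]; have [] := dt t ltac:(lra).
  - apply: derivable_within_continuous => t; rewrite in_itv/= => tuv.
    by have [[]] := dt t tuv.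
  move: tuv; rewrite in_itv/= => /andP[/ltW ut /ltW tv].
  have [_ h] := dt t ltac:(lra).
  have : c * (f v - f u) <= - mu * (v - u).
    by rewrite e mulrA ler_wpM2r// subr_ge0 ltW.
  by rewrite mulrBr; lra.
have nn : `|nu - nu| <= eta by rewrite subrr normr0 ltW.
have Dc : mu * (D / c) = 2 * C / c + mu / c.
  by rewrite /D; field; rewrite !gt_eqF.
have muc : 0 < mu / c by rewrite divr_gt0.
move: fnu; rewrite ler_norml => /andP[f1 f2].
split.
  move=> z zn hz; have fz : f z = 0 by rewrite /f /charlier_ratio hz mul0r.
  have h : mu * `|nu - z| <= 2 * C / c.
    have [zn'|/ltW zn'] := leP z nu.
      have := mono z nu zn nn zn'; rewrite fz ger0_norm ?subr_ge0//; lra.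
    have := mono nu z nn zn zn'; rewrite fz ler0_norm ?subr_le0//; lra.
  by rewrite -(ler_pM2l mu0) Dc; lra.
set r := D / c in Deta Dc *.
have r0 : 0 < r by rewrite divr_gt0.
have up : `|nu + r - nu| <= eta by rewrite addrAC subrr add0r gtr0_norm.
have dn : `|nu - r - nu| <= eta by rewrite addrAC subrr sub0r normrN gtr0_norm.
have g1 := mono nu (nu + r) nn up ltac:(lra).
have g2 := mono (nu - r) nu dn nn ltac:(lra).
have [zu su _] := fd _ up; have [zd sd _] := fd _ dn.
(* Sign changes pass from the ratio to the polynomial itself, to which the intermediate value
   theorem is applied. *)
have fE t : 0 < t -> 0 < sg * charlier a n (t - 1) ->
    sg * charlier a n.+1 t = f t * (t * (sg * charlier a n (t - 1))).
  move=> t0 st; rewrite /f /charlier_ratio /charlier_den.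
  have cn : charlier a n (t - 1) != 0.
    by apply: contraTneq st => ->; rewrite mulr0 ltxx.
  by field; rewrite cn gt_eqF.
have h1 : sg * charlier a n.+1 (nu + r) <= 0.
  rewrite fE// mulr_le0_ge0//; last by rewrite mulr_ge0 ?ltW.
  by rewrite -(pmulr_rle0 _ c0); clear -g1 f2 Dc muc; lra.
have h2 : 0 <= sg * charlier a n.+1 (nu - r).
  rewrite fE// mulr_ge0//; last by rewrite mulr_ge0 ?ltW.
  by rewrite -(pmulr_rge0 _ c0); clear -g2 f1 Dc muc; lra.
have [|||z] := @IVT R (fun t => sg * charlier a n.+1 t) (nu - r) (nu + r) 0.
- by clear -r0; lra.
- apply: continuous_subspaceT => t; apply: cvgMr.
  apply/differentiable_continuous/derivable1_diffP.
  by have [] := is_derive_charlier a n.+1 t.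
- by rewrite ge_min le_max h1 h2 orbT.
rewrite in_itv/= => /andP[z1 z2] /eqP; rewrite mulf_eq0 => /orP[/eqP s0|/eqP hz].
  by move: su; rewrite s0 mul0r ltxx.
by exists z => //; rewrite ler_norml; clear -z1 z2; lra.
Qed.

(** The ceiling is absorbed by taking xi = (a - (n + 1))/c: rounding moves the degree by less than
    1, hence xi by at most 1/c. The threshold on sqrt(2a) makes the index positive, so it can be
    written [n.+1]. *)
Lemma charlier_index_spec x (a : R) : 0 < a -> 2 * `|x| + 2 <= Num.sqrt (2 * a) ->
  let c := Num.sqrt (2 * a) in
  [/\ 0 <= charlier_index x a, c ^+ 2 / 2 = a & exists n xi,
   [/\ `|charlier_index x a|%N = n.+1, n.+1%:R = c ^+ 2 / 2 - xi * c & `|xi - x| <= c^-1]].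
Proof.
move=> a0 xc c.
have x0 := normr_ge0 x; have xx := ler_norm x.
have c2 : 2 <= c by rewrite /c; lra.
have c0 : 0 < c by lra.
have ca : c ^+ 2 / 2 = a.
  by rewrite /c sqr_sqrtr ?mulr_ge0 ?(ltW a0)//; field.
have pos : 0 < a - x * c.
  rewrite -ca; have -> : c ^+ 2 / 2 - x * c = c * (c / 2 - x) by field.
  by rewrite mulr_gt0//; rewrite -/c in xc; lra.
have i0 : 0 < charlier_index x a by rewrite /charlier_index -/c ceil_gt0.
split => //; first exact: ltW.
have [n nE] : exists n, `|charlier_index x a|%N = n.+1.
  exists `|charlier_index x a|%N.-1; rewrite prednK// absz_gt0 gt_eqF//.
exists n, ((a - n.+1%:R) / c); split => //.
  by rewrite divfK ?gt_eqF// ca; ring.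
have iE : (charlier_index x a)%:~R = n.+1%:R :> R.
  by rewrite -nE natr_absz gtr0_norm.
have l1 := ceil_ge (a - x * c); have l2 := ceilB1_lt (a - x * c).
have -> : (a - n.+1%:R) / c - x = - ((n.+1%:R - (a - x * c)) / c).
  by field; rewrite gt_eqF.
rewrite normrN normrM normfV (gtr0_norm c0) ler_piMl ?invr_ge0 ?(ltW c0)//.
rewrite -/(charlier_index x a) -iE ler_norml.
move: l1 l2; rewrite -/c /charlier_index -/c intrB; lra.
Qed.

Lemma near_sqrt_ge (a : nat -> R) (C : R) : a @ \oo --> +oo ->
  \forall j \near \oo, C <= Num.sqrt (2 * a j).
Proof.
move=> /cvgryPge /(_ (C ^+ 2)); apply: filterS => j aj.
have [C0|/ltW C0] := leP C 0; first by rewrite (le_trans C0) ?sqrtr_ge0.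
have h : C ^+ 2 <= 2 * a j by have := sqr_ge0 C; lra.
by rewrite -(ger0_norm C0) -sqrtr_sqr ler_sqrt// (le_trans _ h)// sqr_ge0.
Qed.

Lemma near_bigO_invsqrt (a : nat -> R) (f : nat -> R) (C : R) : 0 < C -> (forall j, 0 < a j) ->
  (\forall j \near \oo, `|f j| <= C / Num.sqrt (2 * a j)) ->
  f =O_\oo (fun j => (Num.sqrt (a j))^-1).
Proof.
move=> C0 a0 fC; apply/eqO_exP; exists C => //.
apply: filterS fC => j /le_trans; apply.
rewrite ger0_norm ?invr_ge0 ?sqrtr_ge0// ler_pM2l// lef_pV2 ?posrE ?sqrtr_gt0 ?mulr_gt0//.
by rewrite ler_sqrt ?mulr_ge0 ?ltW//; have := a0 j; lra.
Qed.

End zeros.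

Theorem theorem5 (R : realType) (x : R) :
  (forall (a nu_ : nat -> R) (nu : R),
      (forall j, 0 < a j) ->
      a @ \oo --> +oo ->
      (forall j, 0 <= charlier_index x (a j) ->
         charlier (a j) `|charlier_index x (a j)|%N (nu_ j) = 0) ->
      nu_ @ \oo --> nu ->
      hermite nu x = 0 /\
      (fun j => nu - nu_ j) =O_\oo (fun j => (Num.sqrt (a j))^-1)) /\
  (forall nu : R,
      0 < nu ->
      hermite nu x = 0 ->
      forall a : nat -> R,
      (forall j, 0 < a j) ->
      a @ \oo --> +oo ->
      exists nu_ : nat -> R,
        [/\ nu_ @ \oo --> nu,
            \forall j \near \oo, 0 <= charlier_index x (a j) /\
              charlier (a j) `|charlier_index x (a j)|%N (nu_ j) = 0
          & (fun j => nu - nu_ j) =O_\oo (fun j => (Num.sqrt (a j))^-1)]).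
Proof.
split=> [a nu_ nu a0 aoo hz nucvg|nu nu0 hnu a a0 aoo].
  have nuge0 : 0 <= nu.
    rewrite leNgt; apply/negP => nu0.
    near \oo => j.
    have xj : 2 * `|x| + 2 <= Num.sqrt (2 * a j) by near: j; exact: near_sqrt_ge.
    have [i0 _ _] := charlier_index_spec (a0 j) xj.
    have nj : nu_ j < 0 by near: j; exact: (cvgr_lt nu).
    have := charlier_gt0 `|charlier_index x (a j)|%N (a0 j) (ltW nj).
    by rewrite hz// ltxx.
  have hnu : hermite nu x = 0.
    have xX : `|x| <= `|x| + 1 by rewrite lerDl.
    have X0 : 0 <= `|x| + 1 by rewrite addr_ge0.
    have [rho [kappa [K [kappa0 K0 rho0 hK]]]] := charlier_hermite_asymp X0 xX nuge0.
    apply/eqP; apply: contraT => h0.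
    pose g := kappa * `|hermite nu x|.
    have g0 : 0 < g by rewrite mulr_gt0// normr_gt0.
    (* At a zero of the polynomial the asymptotics leaves g <= K (1/c + |nu_j - nu| + |xi - x|).
       Once each summand is at most e this contradicts 3Ke < g; [K + 1] keeps the quotient
       meaningful when K = 0. *)
    pose e := g / (3 * (K + 1)).
    have e0 : 0 < e by rewrite divr_gt0// mulr_gt0//; lra.
    have eg : 3 * (K * e) < g.
      have eE : e * (3 * (K + 1)) = g by rewrite divfK// gt_eqF// mulr_gt0//; lra.
      by rewrite -eE; lra.
    near \oo => j.
    have xj : 2 * `|x| + 2 <= Num.sqrt (2 * a j) by near: j; exact: near_sqrt_ge.
    have cX : 2 * (2 * (`|x| + 1) + 1) <= Num.sqrt (2 * a j) by near: j; exact: near_sqrt_ge.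
    have ce : e^-1 <= Num.sqrt (2 * a j) by near: j; exact: near_sqrt_ge.
    have nj1 : `|nu_ j - nu| <= 1.
      by near: j; move/cvgrPdistC_le : nucvg; apply.
    have nje : `|nu_ j - nu| <= e.
      by near: j; move/cvgrPdistC_le : nucvg; apply.
    have [i0 cE [n [xi [iE nE xix]]]] := charlier_index_spec (a0 j) xj.
    set c := Num.sqrt (2 * a j) in xj cX ce cE nE xix.
    have c0 : 0 < c by lra.
    have c1 : c^-1 <= 1 by rewrite invf_le1//; lra.
    have cie : c^-1 <= e by rewrite -[e]invrK lef_pV2 ?posrE ?invr_gt0.
    have xiX : `|xi| <= `|x| + 1.
      have -> : xi = x + (xi - x) by ring.
      by rewrite (le_trans (ler_normD _ _))// lerD2l (le_trans xix).
    have reg : near_regime (`|x| + 1) c n.+1 xi by [].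
    have [h _] := hK _ _ _ _ reg nj1.
    have := hz j i0; rewrite iE -cE => z0.
    move: h; rewrite /scaled_charlier z0 !mulr0 sub0r normrN normrM (gtr0_norm kappa0) -/g.
    have : K * (c^-1 + `|nu_ j - nu| + `|xi - x|) <= K * (3 * e).
      by rewrite ler_wpM2l//; lra.
    lra.
  split=> //; have nu0 : 0 < nu.
    rewrite lt_neqAle nuge0 andbT; apply: contra_eq_neq hnu => <-.
    exact: (hermite0_neq0).
  have [eta [c1 [C [eta0 c10 C0 H]]]] := charlier_zero_near nu0 hnu.
  apply: (@near_bigO_invsqrt _ _ _ C) => //; near=> j.
  have xj : 2 * `|x| + 2 <= Num.sqrt (2 * a j) by near: j; exact: near_sqrt_ge.
  have [i0 cE [n [xi [iE nE xix]]]] := charlier_index_spec (a0 j) xj.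
  have cj : c1 <= Num.sqrt (2 * a j) by near: j; exact: near_sqrt_ge.
  have [h _] := H _ _ _ cj nE xix.
  apply: h; last by rewrite cE -iE hz.
  by near: j; move/cvgrPdistC_le : nucvg; apply.
have [eta [c1 [C [eta0 c10 C0 H]]]] := charlier_zero_near nu0 hnu.
pose P j z := `|nu - z| <= C / Num.sqrt (2 * a j) /\
  charlier (a j) `|charlier_index x (a j)|%N z = 0.
(* A zero within C/c is chosen where one exists; the default nu fills the remaining indices, of
   which there are finitely many. *)
pose nu_ j := xget nu [set z | P j z].
have nuP : \forall j \near \oo, 0 <= charlier_index x (a j) /\ P j (nu_ j).
  near=> j.
  have xj : 2 * `|x| + 2 <= Num.sqrt (2 * a j) by near: j; exact: near_sqrt_ge.
  have [i0 cE [n [xi [iE nE xix]]]] := charlier_index_spec (a0 j) xj.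
  have cj : c1 <= Num.sqrt (2 * a j) by near: j; exact: near_sqrt_ge.
  have [_ [z hz zz]] := H _ _ _ cj nE xix.
  split=> //; rewrite /nu_; apply: (@xgetPex _ nu [set z | P j z]).
  by exists z; split => //; rewrite iE -cE.
exists nu_; split.
- apply/cvgrPdist_le => e e0; near=> j.
  have [_ [h _]] : 0 <= charlier_index x (a j) /\ P j (nu_ j) by near: j.
  apply: (le_trans h).
  have cj : C / e <= Num.sqrt (2 * a j) by near: j; exact: near_sqrt_ge.
  have c0 : 0 < Num.sqrt (2 * a j) by rewrite (lt_le_trans _ cj)// divr_gt0.
  by rewrite ler_pdivrMr// mulrC -ler_pdivrMr.
- by apply: filterS nuP => j [i0 [_]].
- by apply: (@near_bigO_invsqrt _ _ _ C) => //; apply: filterS nuP => j [_ []].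
Unshelve. all: by end_near. Qed.
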